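(* Let $\mathcal{M}$ be an episodic MDP with $S$ states, $A$ actions and horizon $H$ in which $\max_{\pi\in\Pi^S}p_h^\pi(s)>0$ for all $s\in\mathcal{S}$ and $h\in\{2,\dots,H\}$. Let $\delta\in(0,1)$ and let $c$ be a target function. With probability at least $1-\delta$, the stopping time $\tau$ (number of episodes) of CovGame run on $(c,\delta)$ with the learners WMF (for $\mathcal{A}^\lambda$) and UCBVI with changing rewards (for $\mathcal{A}^\Pi$) is bounded by $$\tau\ \le\ 64\,m\,\varphi^\star(c)+\widetilde{O}\big(m\,\varphi^\star(\mathbf{1}_{\mathcal{X}})\,SAH^2(\log(1/\delta)+S)\big),$$ where $m=\lceil\log_2(c_{\max}/c_{\min})\rceil\vee 1$, $c_{\max}=\max_{h,s,a}c_h(s,a)$, $c_{\min}=\min_{(h,s,a)\in\mathcal{X}}c_h(s,a)\vee 1$, and $\widetilde{O}$ hides poly-logarithmic factors in $S,A,H,\varphi^\star(\mathbf{1}_{\mathcal{X}}),\log(1/\delta)$.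
   Context: Setting. $\mathcal{M}=(\mathcal{S},\mathcal{A},\{p_h\}_{h\in[H]},s_1,H)$ is a finite-horizon MDP with unknown transitions. In each episode $t$ the learner plays a policy $\pi^t$ from $s_1$ and observes the trajectory $(s_h^t,a_h^t)_{h\in[H]}$; $n_h^t(s,a)$ is the number of visits to $(s,a)$ at stage $h$ in the first $t$ episodes. $\Pi^S$ is the set of stochastic policies, $p_h^\pi(s,a)$, $p_h^\pi(s)$ are the stage-$h$ visitation probabilities under $\pi$, and $\Omega=\{p^\pi:\pi\in\Pi^S\}$. A target function is a map $c:[H]\times\mathcal{S}\times\mathcal{A}\to\mathbb{R}$; $\mathcal{X}=\{(h,s,a):c_h(s,a)>0\}$; $\varphi^\star(c)=\inf_{\rho\in\Omega}\max_{(h,s,a):c_h(s,a)>0}c_h(s,a)/\rho_h(s,a)$; $\mathbf{1}_{\mathcal{X}}$ is the indicator of $\mathcal{X}$; $\mathcal{P}(\cdot)$ denotes the set of probability distributions. Let $\mathcal{X}_0=\mathcal{X}$ and $\mathcal{X}_k=\{(h,s,a):c_h(s,a)>c_{\min}2^k\}$ for $k\ge1$. Algorithm CovGame$(c,\delta)$. Initialize $n^0=0$, $k_1=0$, instantiate $\mathcal{A}^\lambda$ on $\mathcal{P}(\mathcal{X})$ and let $\lambda^1$ be uniform on $\mathcal{X}$. For $t=1,2,\dots$: (i) get $\pi^t$ from $\mathcal{A}^\Pi$ given reward $\lambda^t$, run with confidence $1-\delta/2$ (never reset); (ii) play $\pi^t$ for one episode and update the counts to $n^t$; (iii) if $n_h^t(s,a)\ge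 c_h(s,a)$ for all $(h,s,a)$, stop, set $\tau=t$ and return all sampled trajectories; (iv) set $k_{t+1}=\max\{j\in\mathbb{N}:n_h^t(s,a)\ge c_h(s,a)\ \forall(h,s,a)\in\mathcal{X}\setminus\mathcal{X}_j\}$; (v) if $k_{t+1}\ne k_t$, reset $\mathcal{A}^\lambda$ on $\mathcal{P}(\mathcal{X}_{k_{t+1}})$ and let $\lambda^{t+1}$ be uniform on $\mathcal{X}_{k_{t+1}}$; otherwise feed $\mathcal{A}^\lambda$ the loss $\ell^t(\lambda)=\sum_{(h,s,a)\in\mathcal{X}_{k_t}}\lambda_h(s,a)\mathbf{1}(s_h^t=s,a_h^t=a)$ and get $\lambda^{t+1}$ from it. $\mathcal{A}^\lambda$ = WMF: the weighted majority (exponentially weighted average) forecaster with the variance-dependent learning rate of Cesa-Bianchi, Mansour and Stoltz. Its known guarantee, taken as given: when instantiated on $\mathcal{P}(\mathcal{X}_k)$, for any linear losses $\ell^t$ bounded in $[0,1]$ and all $T\ge 1$, $\sum_{t\le T}\ell^t(\lambda^t)-\min_{\lambda\in\mathcal{P}(\mathcal{X}_k)}\sum_{t\le T}\ell^t(\lambda)\le\sqrt{R\sum_{t\le T}\ell^t(\lambda^t)}+R$ with $R=16\log(SAH)$. $\mathcal{A}^\Pi$ = UCBVI with changing rewards, run with confidence $1-\delta'$. Let $\widehat p_h^t(\cdot|s,a)$ be the empirical transition frequencies after $t$ episodes, $\widehat{P}^t_{h,s,a}f=\sum_{s'}\widehat p_h^t(s'|s,a)f(s')$, $\mathbb{V}(\widehat{P}^t_{h,s,a},f)$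 the variance of $f$ under $\widehat p_h^t(\cdot|s,a)$, and $\beta(n,\delta')=\log(2SAH/\delta')+S\log(8e(n+1))$. For a reward $r$: $\overline{Q}_H^t(s,a;r)=r_H(s,a)$, $\overline{V}_h^t(s;r)=\max_a\overline{Q}_h^t(s,a;r)$ and, for $h<H$, $\overline{Q}_h^t(s,a;r)=\big(r_h(s,a)+\widehat{P}^t_{h,s,a}\overline{V}^t_{h+1}(r)+B_h^t(s,a;r)\big)\wedge 1$, with $B_h^t(s,a;r)=\max\Big\{\sqrt{\tfrac{8\mathbb{V}(\widehat{P}^t_{h,s,a},\overline{V}^t_{h+1}(r))\beta(n_h^t(s,a),\delta')}{n_h^t(s,a)}},\tfrac{8\beta(n_h^t(s,a),\delta')}{n_h^t(s,a)}\Big\}$ ($=+\infty$ if $n_h^t(s,a)=0$). In episode $t$ with revealed reward $\lambda^t$ it plays $\pi_h^t(s)\in\arg\max_a\overline{Q}_h^{t-1}(s,a;\lambda^t)$. *)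

(* Defs.v *)
(* MathComp / MathComp-Analysis. *)
From mathcomp Require Import all_boot all_order all_algebra.
From mathcomp Require Import all_classical all_reals all_analysis.

Set Implicit Arguments.
Unset Strict Implicit.
Unset Printing Implicit Defensive.

Import Order.TTheory GRing.Theory Num.Theory.
Local Open Scope classical_set_scope.
Local Open Scope ring_scope.

(** * Finite distributions *)

Definition is_dist (R : realType) (T : finType) (f : T -> R) : Prop :=
  (forall x, 0 <= f x) /\ \sum_x f x = 1.

(* P(D), as distributions on the ambient type vanishing outside D *)
Definition simplex (R : realType) (T : finType) (D : {set T}) (f : T -> R) :
    Prop :=
  is_dist f /\ (forall x, x \notin D -> f x = 0).

Definition mean (R : realType) (T : finType) (p f : T -> R) : R :=
  \sum_x p x * f x.

Definition var (R : realType) (T : finType) (p f : T -> R) : R :=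
  mean p (fun x => (f x - mean p f) ^+ 2).

(** * Episodic MDPs *)

(* Stages are numbered from 0 to H - 1.  The kernel of the last stage is part
   of the data but plays no role, since an episode ends after H actions. *)
Record mdp (R : realType) (S A : finType) (H : nat) := MDP {
  init : S;
  trans : 'I_H -> S * A -> S -> R;
  trans_dist : forall h sa, is_dist (trans h sa)
}.

(* A stage-state-action triple (h, s, a) is encoded as (h, (s, a)). *)
Notation triple S A H := ('I_H * (S * A))%type.

(* The sequence ((s_h, a_h))_h observed during one episode. *)
Notation traj S A H := {ffun 'I_H -> S * A}.

Definition policy (R : realType) (S A : finType) (H : nat) : Type :=
  'I_H -> S -> A -> R.

Definition stochastic_policy (R : realType) (S A : finType) (H : nat)
    (pi : policy R S A H) : Prop :=
  forall h s, is_dist (pi h s).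

Definition det_policy (R : realType) (S A : finType) (H : nat)
    (f : 'I_H -> S -> A) : policy R S A H :=
  fun h s a => (a == f h s)%:R.

Section Occupancy.
Variables (R : realType) (S A : finType) (H : nat).
Variable M : mdp R S A H.

(* Probability of the trajectory z when the policy pi is played for one
   episode.  ord_pred h is stage h - 1; it is only read when h is not the
   first stage. *)
Definition traj_prob (pi : policy R S A H) (z : traj S A H) : R :=
  \prod_(h < H)
    ((if h == 0%N :> nat then ((z h).1 == init M)%:R
      else trans M (ord_pred h) (z (ord_pred h)) (z h).1)
     * pi h (z h).1 (z h).2).

Definition visit (pi : policy R S A H) (x : triple S A H) : R :=
  \sum_(z : traj S A H | z x.1 == x.2) traj_prob pi z.

Definition state_visit (pi : policy R S A H) (h : 'I_H) (s : S) : R :=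
  \sum_(z : traj S A H | (z h).1 == s) traj_prob pi z.

Definition Omega : set (triple S A H -> R) :=
  [set rho | exists2 pi, stochastic_policy pi & rho = visit pi].

(* Division is the extended one: a zero visitation probability gives +oo. *)
Definition phi_star (c : triple S A H -> R) : \bar R :=
  ereal_inf
    [set \big[Order.max/-oo%E]_(x | 0 < c x) ((c x)%:E / (rho x)%:E)%E
    | rho in Omega].

End Occupancy.

(** * Target functions *)

Section Target.
Variables (R : realType) (S A : finType) (H : nat).
Variable c : triple S A H -> R.

Definition supp : {set triple S A H} := finset.finset (fun x => 0 < c x).

Definition ind_supp (x : triple S A H) : R := (x \in supp)%:R.

(* The idle values of the two iterated operators below are irrelevant when
   supp is nonempty. *)
Definition cmax : R := \big[Order.max/0]_x c x.

Definition cmin : R :=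
  Order.max (\big[Order.min/cmax]_(x in supp) c x) 1.

Definition num_levels : R :=
  Order.max ((Num.ceil (ln (cmax / cmin) / ln 2))%:~R) 1.

(* X_k *)
Definition level_set (k : nat) : {set triple S A H} :=
  if k is 0%N then supp else finset.finset (fun x => cmin * 2 ^+ k < c x).

End Target.

(** * The weighted majority forecaster

   Learning rate of Cesa-Bianchi, Mansour and Stoltz for losses of known range
   1: eta_t = min (1, C sqrt (log N / V_(t-1))), where N is the number of
   experts and V_(t-1) the sum over the past rounds of the variance of the
   losses under the forecaster's own predictions.  Lists of losses have the
   most recent one first. *)

Section WMF.
Variables (R : realType) (T : finType).
Variable D : {set T}.

Definition exp_weights (eta : R) (L : T -> R) (x : T) : R :=
  if x \in D then expR (- (eta * L x)) / \sum_(y in D) expR (- (eta * L y))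
  else 0.

Definition cumul (ys : seq (T -> R)) (x : T) : R := \sum_(y <- ys) y x.

Definition rate_const : R :=
  Num.sqrt (2 * (Num.sqrt 2 - 1) / (expR 1 - 2)).

(* V = 0 stands for an infinite second argument of the minimum *)
Definition wmf_rate (V : R) : R :=
  if V == 0 then 1
  else Order.min 1 (rate_const * Num.sqrt (ln (#|D|%:R) / V)).

Fixpoint wmf_var (ys : seq (T -> R)) : R :=
  if ys is y :: ys' then
    wmf_var ys' + var (exp_weights (wmf_rate (wmf_var ys')) (cumul ys')) y
  else 0.

(* Uniform on D when no loss has been received. *)
Definition wmf (ys : seq (T -> R)) : T -> R :=
  exp_weights (wmf_rate (wmf_var ys)) (cumul ys).

End WMF.

(* Regret guarantee, with constant B, of a learner on P(D) against linear
   losses.  y t is the vector of coefficients of the loss of round t + 1, so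
   the corresponding linear loss is lambda |-> mean lambda (y t). *)
Definition regret_guarantee (R : realType) (T : finType) (D : {set T})
    (learner : seq (T -> R) -> T -> R) (B : R) : Prop :=
  forall (y : nat -> T -> R) (n : nat),
    (forall t x, 0 <= y t x <= 1) -> (0 < n)%N ->
    let loss := \sum_(t < n) mean (learner (rev (mkseq y t))) (y t) in
    forall lambda, simplex D lambda ->
      loss - \sum_(t < n) mean lambda (y t) <= Num.sqrt (B * loss) + B.

(** * UCBVI with changing rewards

   A history is the list of the trajectories of the past episodes, the most
   recent one first. *)

Section UCBVI.
Variables (R : realType) (S A : finType) (H : nat).

(* n_h^t(s,a) *)
Definition visits (w : seq (traj S A H)) (x : triple S A H) : nat :=
  count (fun z : traj S A H => z x.1 == x.2) w.

(* ordS h is stage h + 1; only used when h is not the last stage. *)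
Definition emp_trans (w : seq (traj S A H)) (x : triple S A H) (s' : S) : R :=
  (count (fun z : traj S A H =>
            (z x.1 == x.2) && ((z (ordS x.1)).1 == s')) w)%:R
  / (visits w x)%:R.

Definition beta (n : nat) (delta' : R) : R :=
  ln (2 * #|S|%:R * #|A|%:R * H%:R / delta')
  + #|S|%:R * ln (8 * expR 1 * n.+1%:R).

Definition bonus (delta' : R) (w : seq (traj S A H)) (x : triple S A H)
    (V : S -> R) : R :=
  let n := visits w x in
  Order.max
    (Num.sqrt (8 * var (emp_trans w x) V * beta n delta' / n%:R))
    (8 * beta n delta' / n%:R).

(* k is the number of stages after stage h.  The value is 1 on unvisited
   triples because the bonus is then infinite.  The idle value 0 of the
   maximum over actions is harmless because rewards are nonnegative. *)
Fixpoint ucb_Q_rec (delta' : R) (w : seq (traj S A H))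
    (r : triple S A H -> R) (k : nat) (h : 'I_H) (sa : S * A) : R :=
  if k is k'.+1 then
    let V s := \big[Order.max/0]_(a : A)
                 ucb_Q_rec delta' w r k' (ordS h) (s, a) in
    if visits w (h, sa) == 0%N then 1
    else Order.min (r (h, sa) + mean (emp_trans w (h, sa)) V
                    + bonus delta' w (h, sa) V) 1
  else r (h, sa).

Definition ucb_Q (delta' : R) (w : seq (traj S A H)) (r : triple S A H -> R)
    (h : 'I_H) (s : S) (a : A) : R :=
  ucb_Q_rec delta' w r (H - h.+1) h (s, a).

(* f is a policy that the algorithm may play after history w for the reward
   r; ties are broken arbitrarily. *)
Definition ucbvi_plays (delta' : R) (w : seq (traj S A H))
    (r : triple S A H -> R) (f : 'I_H -> S -> A) : Prop :=
  forall h s a, ucb_Q delta' w r h s a <= ucb_Q delta' w r h s (f h s).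

End UCBVI.

(** * CovGame *)

Section CovGame.
Variables (R : realType) (S A : finType) (H : nat).
Variable c : triple S A H -> R.

Definition covered (w : seq (traj S A H)) : bool :=
  [forall x, c x <= (visits w x)%:R].

Definition level_done (w : seq (traj S A H)) (j : nat) : bool :=
  [forall x : triple S A H,
     (x \in supp c) && (x \notin level_set c j) ==> (c x <= (visits w x)%:R)].

(* level w is k_{t+1} for a history w of t episodes.  The maximum exists as
   long as w is not covered, that is, as long as the algorithm is running. *)
Definition level (w : seq (traj S A H)) : nat :=
  if w is [::] then 0%N
  else xget 0%N
    [set j | level_done w j /\ forall i, level_done w i -> (i <= j)%N].

Definition traj_loss (z : traj S A H) (x : triple S A H) : R :=
  (z x.1 == x.2)%:R.

(* Losses fed to the lambda-player since its last reset.  The restriction of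
   the loss to the current level set is immaterial, as the forecaster on
   P(X_k) only reads the coordinates in X_k. *)
Fixpoint losses (w : seq (traj S A H)) : seq (triple S A H -> R) :=
  if w is z :: w' then
    if level w == level w' then traj_loss z :: losses w' else [::]
  else [::].

(* lambda^{t+1} *)
Definition lambda_next (w : seq (traj S A H)) : triple S A H -> R :=
  wmf (level_set c (level w)) (losses w).

End CovGame.

Section Run.
Variables (R : realType) (S A : finType) (H : nat).
Variables (d : measure_display) (T : measurableType d) (P : probability T R).

(* X t is the trajectory of episode t + 1. *)
Fixpoint hist (X : nat -> T -> traj S A H) (t : nat) (w : T) :
    seq (traj S A H) :=
  if t is t'.+1 then X t' w :: hist X t' w else [::].

(* X is the sequence of trajectories of a run of CovGame: as long as the
   targets are not covered, the policy of the next episode is a policy of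
   UCBVI for the current reward, and the next trajectory is distributed, given
   the past ones, as an episode of M under that policy.  What happens after
   the algorithm has stopped is left unconstrained. *)
Record covgame_run (M : mdp R S A H) (c : triple S A H -> R) (delta : R)
    (pol : seq (traj S A H) -> 'I_H -> S -> A)
    (X : nat -> T -> traj S A H) : Prop := CovGameRun {
  run_meas : forall t z, measurable [set w | X t w = z];
  run_pol : forall u, ~~ covered c u ->
    ucbvi_plays (delta / 2) u (lambda_next c u) (pol u);
  run_law : forall t u z, size u = t -> ~~ covered c u ->
    P [set w | hist X t.+1 w = z :: u] =
    (P [set w | hist X t w = u]
     * (traj_prob M (det_policy R (pol u)) z)%:E)%E
}.

(* +oo if the algorithm never stops *)
Definition tau (c : triple S A H -> R) (X : nat -> T -> traj S A H) (w : T) :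
    \bar R :=
  ereal_inf [set (t%:R)%:E | t in [set t | (0 < t)%N && covered c (hist X t w)]].

End Run.

(** * Logarithmic factors *)

(* Any polylogarithmic expression in S, A, H, phi and log (1 / delta) is at
   most a constant times a power of this quantity.  Every summand is
   nonnegative in the range of interest (phi >= 1). *)
Definition log_factor (R : realType) (S A H : nat) (phi delta : R) : R :=
  1 + ln S%:R + ln A%:R + ln H%:R + ln phi + ln (1 + ln (1 / delta)).

(* Main.v *)
(* On an event of probability 1 - delta, supplied by Ville's inequality for a
   mixture of supermartingales on the tree of histories, every transition
   kernel is within relative entropy beta(n) / n of its empirical version (the
   likelihood ratio of Laplace's estimator), and the realized gains and
   confidence widths dominate half of their conditional expectations up to
   O(log(1 / delta)).

   On that event UCBVI is optimistic, and the telescoping of the squared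
   optimistic values gives, in each episode with reward lambda,
     V* <= 2 V^pi + 82 E^pi[sum of the widths min(1, beta(n) / n)].
   While level k is active V* >= 1 / g_k with g_k <= phi*(1_X) and
   g_k c_min 2^k <= phi*(c) + phi*(1_X), up to factors 2.  Multiplying by g_k
   and summing over episodes bounds tau by the weighted losses of the forecaster
   plus the sum of the widths.  The regret guarantee bounds the former level by
   level, because in phase k some triple of X_k has been visited less than
   c_min 2^(k+1) times; the pigeonhole principle bounds the latter by
   SAH (1 + beta(tau) (1 + ln tau)).  Solving tau <= x + Y (l + ln tau)^2 either
   as tau <= 2 x or as tau <= 2 Y (l + ln tau)^2 keeps ln m and ln phi*(c) out
   of the logarithmic factor. *)

Require Import Defs.
From mathcomp Require Import all_boot all_order all_algebra.
From mathcomp Require Import all_classical all_reals all_analysis.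
From mathcomp Require Import ring lra.

Set Implicit Arguments.
Unset Strict Implicit.
Unset Printing Implicit Defensive.

Import Order.TTheory GRing.Theory Num.Theory.
Local Open Scope classical_set_scope.
Local Open Scope ring_scope.

(** * Bernstein's inequality from an entropy bound *)

(** The value functions of UCBVI are built from the very samples that estimate the kernels, so a
    deviation bound for one fixed function would not apply to them. The entropy bound is therefore
    kept in dual form, for all test functions at once, and Bernstein's inequality follows from it
    without a union bound over value functions. Deviations and episodes need no union bound either:
    all supermartingales are averaged with constant weights into a single one, which starts at most
    at 1 and is compared with 1 / delta. Only Ville's inequality sees the probability space; the
    estimates before and after it concern a fixed list of trajectories. The constant 64 is 2 * 2 * 4
    * 2 * 2. The factors come from the optimistic telescoping, the passage from conditional to
    realized gains, the self-bounded regret against a threshold cmin 2^(k+1), the policies that are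
    optimal only up to a factor 2 because no minimizer in [phi_star] is assumed, and the final case
    split on the logarithms. *)

Section Mean.
Variables (R : realType) (T : finType).
Implicit Types p f g : T -> R.

Lemma meanD p f g : mean p (fun x => f x + g x) = mean p f + mean p g.
Proof. by rewrite /mean -big_split; apply: eq_bigr => x _; rewrite mulrDr. Qed.

Lemma meanZ p a f : mean p (fun x => a * f x) = a * mean p f.
Proof. by rewrite /mean mulr_sumr; apply: eq_bigr => x _; rewrite mulrCA. Qed.

Lemma mean_cst p a : is_dist p -> mean p (fun=> a) = a.
Proof. by case=> _ p1; rewrite /mean -mulr_suml p1 mul1r. Qed.

Lemma ler_mean p f g : is_dist p -> (forall x, f x <= g x) ->
  mean p f <= mean p g.
Proof. by case=> p0 _ fg; apply: ler_sum => x _; rewrite ler_wpM2l. Qed.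

Lemma mean_ge0 p f : is_dist p -> (forall x, 0 <= f x) -> 0 <= mean p f.
Proof. by case=> p0 _ f0; apply: sumr_ge0 => x _; rewrite mulr_ge0. Qed.

Lemma mean_le1 p f : is_dist p -> (forall x, f x <= 1) -> mean p f <= 1.
Proof. by move=> dp f1; rewrite -[leRHS](mean_cst 1 dp); apply: ler_mean. Qed.

Lemma mean_sq_center p f a : is_dist p ->
  mean p (fun x => (f x - a) ^+ 2) =
  mean p (fun x => f x ^+ 2) - 2 * a * mean p f + a ^+ 2.
Proof.
move=> dp.
transitivity (mean p (fun x => (f x ^+ 2 + (- (2 * a)) * f x) + a ^+ 2)).
  by rewrite /mean; apply: eq_bigr => x _; congr (_ * _); ring.
by rewrite !meanD meanZ mean_cst //; ring.
Qed.

Lemma varE p f : is_dist p ->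
  var p f = mean p (fun x => f x ^+ 2) - mean p f ^+ 2.
Proof. by move=> dp; rewrite /var mean_sq_center //; ring. Qed.

Lemma var_ge0 p f : is_dist p -> 0 <= var p f.
Proof. by move=> dp; apply: mean_ge0 => // x; exact: sqr_ge0. Qed.

Lemma var_le_center p f a : is_dist p ->
  var p f <= mean p (fun x => (f x - a) ^+ 2).
Proof.
move=> dp; rewrite varE // mean_sq_center //.
have := sqr_ge0 (mean p f - a); nra.
Qed.

(** Since e^x = (e^(-x/2))^(-2) and e^(-x/2) >= 1 - x/2, a polynomial inequality is left, whose
    remainder has the sign of 1 - 3x + x^2; this is where 1/3 comes from. *)
Lemma expR_le_quad (x : R) : x <= 3^-1 -> expR x <= 1 + x + x ^+ 2.
Proof.
move=> x3.
have h0 : 0 < 1 - x / 2 by lra.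
have h1 : 1 - x / 2 <= expR (- (x / 2)).
  by have := expR_ge1Dx (- (x / 2)).
have e0 : 0 < expR (- (x / 2)) by exact: expR_gt0.
have -> : expR x = (expR (- (x / 2)) ^+ 2)^-1.
  rewrite -exprVn -expRN opprK expr2 -expRD; congr expR; lra.
have h2 : (1 - x / 2) ^+ 2 <= expR (- (x / 2)) ^+ 2.
  by rewrite ler_sqr // nnegrE ltW.
apply: (@le_trans _ _ ((1 - x / 2) ^+ 2)^-1).
  by rewrite lef_pV2 ?posrE ?exprn_gt0.
rewrite -[leLHS]mul1r ler_pdivrMr ?exprn_gt0 //.
have -> : (1 + x + x ^+ 2) * (1 - x / 2) ^+ 2 =
  1 + x ^+ 2 / 4 * (1 - 3 * x + x ^+ 2) by field.
rewrite lerDl mulr_ge0 //; first by rewrite divr_ge0 // sqr_ge0.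
have := sqr_ge0 x; lra.
Qed.

(* By the Donsker-Varadhan formula, this says that the relative entropy of ph
   with respect to p is at most k. *)
Definition entropy_le (p ph : T -> R) (k : R) : Prop :=
  forall g, mean ph g <= ln (mean p (fun x => expR (g x))) + k.

Section Bernstein.
Variables (p ph : T -> R) (k : R).
Hypotheses (dp : is_dist p) (dph : is_dist ph) (dv : entropy_le p ph k).

Lemma ln_mean_expR_le g : (forall x, g x <= 3^-1) -> mean p g = 0 ->
  ln (mean p (fun x => expR (g x))) <= mean p (fun x => g x ^+ 2).
Proof.
move=> g3 g0.
have le1 : mean p (fun x => expR (g x)) <= 1 + mean p (fun x => g x ^+ 2).
  apply: le_trans (ler_mean dp (fun x => expR_le_quad (g3 x))) _.
  by rewrite !meanD g0 mean_cst // addr0.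
have sq0 : 0 <= mean p (fun x => g x ^+ 2).
  by apply: mean_ge0 => // x; exact: sqr_ge0.
case: (ltP 0 (mean p (fun x => expR (g x)))) => [e0|]; last first.
  by move=> /ln0 ->.
apply: le_trans (_ : ln (1 + mean p (fun x => g x ^+ 2)) <= _).
  by rewrite ler_ln ?posrE // ltr_wpDr.
have := @le_ln1Dx R (mean p (fun x => g x ^+ 2)) ltac:(lra); lra.
Qed.

(** The entropy bound is tested on the centred function scaled by [eta], and the result divided by
    [eta]. The condition [eta <= 4^-1] keeps the test function below 1/3, the range of the quadratic
    bound on exp; the sign [s] selects the tail. *)
Lemma bernstein_side f eta s : (forall x, 0 <= f x <= 1) ->
  0 < eta -> eta <= 4^-1 -> (s = 1 \/ s = - 1) ->
  s * (mean ph f - mean p f) <= k / eta + eta * var p f.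
Proof.
move=> f01 eta0 eta4 hs.
have pf0 : 0 <= mean p f by apply: mean_ge0 => // x; case/andP: (f01 x).
have pf1 : mean p f <= 1 by apply: mean_le1 => // x; case/andP: (f01 x).
have s2 : s ^+ 2 = 1 by case: hs => ->; ring.
pose g x := eta * s * (f x + (- mean p f)).
have E1 : mean ph g = eta * (s * (mean ph f - mean p f)).
  by rewrite /g meanZ meanD mean_cst //; ring.
have E2 : mean p g = 0 by rewrite /g meanZ meanD mean_cst // subrr mulr0.
have E3 : mean p (fun x => g x ^+ 2) = eta ^+ 2 * var p f.
  rewrite /var -meanZ; apply: eq_bigr => x _; congr (_ * _).
  by rewrite /g !exprMn s2 mulr1.
have := dv g; rewrite E1 => h.
have h2 : ln (mean p (fun x => expR (g x))) <= eta ^+ 2 * var p f.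
  rewrite -E3; apply: ln_mean_expR_le => // x.
  have /andP[fx0 fx1] := f01 x; rewrite /g; case: hs => ->; nra.
have h3 : eta * (s * (mean ph f - mean p f)) <= eta ^+ 2 * var p f + k by lra.
rewrite -(ler_pM2l eta0); apply: le_trans h3 _.
rewrite le_eqVlt; apply/orP; left; apply/eqP; field; lra.
Qed.

Lemma bernstein f eta : (forall x, 0 <= f x <= 1) ->
  0 < eta -> eta <= 4^-1 ->
  `|mean ph f - mean p f| <= k / eta + eta * var p f.
Proof.
move=> f01 eta0 eta4; rewrite ler_norml.
have h1 := bernstein_side f01 eta0 eta4 (or_introl (erefl 1)).
have h2 := bernstein_side f01 eta0 eta4 (or_intror (erefl (- 1))).
by apply/andP; split; lra.
Qed.

(** A function with values in [0,1] has variance at most its mean, so Bernstein's inequality becomes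
    a multiplicative comparison of means. It is meant for squared deviations, to exchange true and
    empirical variances. *)
Lemma mean_sq_compare u : (forall x, 0 <= u x <= 1) ->
  `|mean ph u - mean p u| <= 4 * k + 4^-1 * mean p u.
Proof.
move=> u01.
have h := @bernstein u 4^-1 u01 ltac:(lra) ltac:(lra).
have hv : var p u <= mean p u.
  have := sqr_ge0 (mean p u).
  have : mean p (fun x => u x ^+ 2) <= mean p u.
    apply: ler_mean => // x; have /andP[u0 u1] := u01 x; nra.
  rewrite varE //; lra.
apply: le_trans h _; lra.
Qed.

Lemma sq_center01 f a : (forall x, 0 <= f x <= 1) -> 0 <= a <= 1 ->
  forall x, 0 <= (f x - a) ^+ 2 <= 1.
Proof.
move=> f01 /andP[a0 a1] x; have /andP[f0 f1] := f01 x.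
by rewrite sqr_ge0 /=; nra.
Qed.

Lemma mean01 q f : is_dist q -> (forall x, 0 <= f x <= 1) -> 0 <= mean q f <= 1.
Proof.
move=> dq f01; rewrite mean_ge0 ?mean_le1 // => x; by case/andP: (f01 x).
Qed.

(** Centring at the empirical mean only increases the second moment under [p], and makes the other
    side of the comparison exactly the empirical variance. *)
Lemma var_le_emp f : (forall x, 0 <= f x <= 1) ->
  var p f <= 4 / 3 * var ph f + 16 / 3 * k.
Proof.
move=> f01; have m01 := mean01 dph f01.
have := mean_sq_compare (sq_center01 f01 m01).
rewrite -/(var ph f) ler_norml => /andP[h _].
have := var_le_center f (mean ph f) dp; lra.
Qed.

Lemma emp_var_le f : (forall x, 0 <= f x <= 1) ->
  var ph f <= 5 / 4 * var p f + 4 * k.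
Proof.
move=> f01; have m01 := mean01 dp f01.
have := mean_sq_compare (sq_center01 f01 m01).
rewrite -/(var p f) ler_norml => /andP[_ h].
have := var_le_center f (mean p f) dph; lra.
Qed.

Definition bern_bonus f : R :=
  Num.max (Num.sqrt (8 * var ph f * k)) (8 * k).

Hypothesis k0 : 0 < k.

(* [eta = r / (4 v)] balances [k / eta] and [2 eta v] and yields exactly
   [r = sqrt (8 v k)] when [8 k <= v]; otherwise [eta = 1/4] yields [8 k]. *)
Lemma bern_bonus_valid f : (forall x, 0 <= f x <= 1) ->
  `|mean ph f - mean p f| <= bern_bonus f.
Proof.
move=> f01; rewrite /bern_bonus le_max; apply/orP.
have hv := var_le_emp f01; have v0 := var_ge0 f dph.
move: (var ph f) hv v0 => v hv v0.
case: (leP (8 * k) v) => hk; [left|right].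
  have vp : 0 < v by apply: lt_le_trans hk; rewrite mulr_gt0.
  have vk : 8 * v * k <= v ^+ 2.
    by rewrite mulrAC expr2 ler_wpM2r.
  have [r rp r2] : exists2 r : R, 0 < r & r ^+ 2 = 8 * v * k.
    exists (Num.sqrt (8 * v * k)); first by rewrite sqrtr_gt0 !mulr_gt0.
    by rewrite sqr_sqrtr // !mulr_ge0 // ltW.
  rewrite -r2 sqrtr_sqr (gtr0_norm rp).
  have rv : r <= v.
    by rewrite -(@ler_sqr _ r v) ?nnegrE ?(ltW rp) ?(ltW vp) // r2.
  have := @bernstein f (r / (4 * v)) f01.
  have -> : 0 < r / (4 * v) by rewrite divr_gt0 // mulr_gt0.
  have -> : r / (4 * v) <= 4^-1.
    rewrite ler_pdivrMr ?mulr_gt0 //. lra.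
  move=> /(_ isT isT) /le_trans; apply.
  have -> : k / (r / (4 * v)) = r / 2.
    have -> : k = r ^+ 2 / (8 * v) by rewrite r2; field; lra.
    by field; rewrite !gt_eqF.
  have : r / (4 * v) * var p f <= r / (4 * v) * (2 * v).
    by rewrite ler_pM2l ?divr_gt0 ?mulr_gt0 //; lra.
  have -> : r / (4 * v) * (2 * v) = r / 2 by field; rewrite gt_eqF.
  lra.
have := @bernstein f 4^-1 f01 ltac:(lra) ltac:(lra).
rewrite invrK => /le_trans; apply; lra.
Qed.

(** The deviation and the bonus are both at most one bonus, and the split sqrt(8 v k) <= v/10 + 20k
    bounds each by a true variance over 8 plus 41k/2. The resulting coefficient 1/4 is the one for
    which the squares cancel in [optimism_step]. *)
Lemma emp_mean_bonus_le f : (forall x, 0 <= f x <= 1) ->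
  mean ph f + bern_bonus f <= mean p f + 4^-1 * var p f + 41 * k.
Proof.
move=> f01; have := bern_bonus_valid f01.
rewrite ler_norml => /andP[_ h].
have kp : 0 < k := k0.
have hv := emp_var_le f01; have v0 := var_ge0 f dph.
have vp0 := var_ge0 f dp.
suff : bern_bonus f <= 8^-1 * var p f + 41 / 2 * k.
  move: (bern_bonus f) h => b h hb.
  have h1 : mean ph f - mean p f <= b := h.
  have h2 : b <= 8^-1 * var p f + 41 / 2 * k := hb.
  lra.
have h8 : 8 * k <= 8^-1 * var p f + 41 / 2 * k by lra.
rewrite /bern_bonus ge_max h8 andbT.
have : Num.sqrt (8 * var ph f * k) <= var ph f / 10 + 20 * k.
  have h0 : 0 <= var ph f / 10 + 20 * k by lra.
  rewrite -[leRHS](ger0_norm h0) -sqrtr_sqr ler_wsqrtr //.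
  have := sqr_ge0 (var ph f / 10 - 20 * k); lra.
by move=> /le_trans; apply; lra.
Qed.

End Bernstein.
End Mean.

(** * Expectations over trajectories *)

Section Trajectories.
Variables (R : realType) (S A : finType) (H : nat).
Variable M : mdp R S A H.
Implicit Types (pi : policy R S A H) (z : traj S A H) (r : triple S A H -> R).

Lemma ord_pred_val (h : 'I_H) : (0 < h)%N -> ord_pred h = h.-1 :> nat.
Proof.
case: h => -[|h] //= hH _.
by rewrite modnDr modn_small // ltnW.
Qed.

Lemma ordS_val (h : 'I_H) : (h.+1 < H)%N -> ordS h = h.+1 :> nat.
Proof. by move=> hH; rewrite /= modn_small. Qed.

Definition upd z (h : 'I_H) (y : S * A) : traj S A H :=
  [ffun j => if j == h then y else z j].

Lemma upd_at z h y : upd z h y h = y.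
Proof. by rewrite ffunE eqxx. Qed.

Lemma upd_other z h y j : j != h -> upd z h y j = z j.
Proof. by rewrite ffunE => /negbTE ->. Qed.

(** Exchanging the coordinate of [z] at stage [h] with [y] is an involution on pairs. This allows a
    single stage to be summed out while all trajectories keep their full length. *)
Lemma sum_upd h (G : traj S A H -> R) :
  \sum_z \sum_y G (upd z h y) = #|{: S * A}|%:R * \sum_z G z.
Proof.
pose phi (q : traj S A H * (S * A)) := (upd q.1 h q.2, q.1 h).
have phiK : involutive phi.
  move=> [z y]; rewrite /phi /= upd_at; congr (_, _).
  by apply/ffunP => j; rewrite !ffunE; case: eqP => [->|].
rewrite pair_big /= (reindex_inj (inv_inj phiK)) /=.
transitivity (\sum_(q : traj S A H * (S * A)) G q.1).
  apply: eq_bigr => -[z y] _ /=; congr G.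
  by apply/ffunP => j; rewrite !ffunE; case: eqP => [->|].
rewrite -(pair_big xpredT xpredT (fun z _ => G z)) /= mulr_sumr.
by apply: eq_bigr => z _; rewrite big_const iter_addr_0 mulr_natl.
Qed.

Definition step_prob pi (h : 'I_H) z (y : S * A) : R :=
  (if h == 0%N :> nat then (y.1 == init M)%:R
   else trans M (ord_pred h) (z (ord_pred h)) y.1) * pi h y.1 y.2.

Definition prefix_prob pi (k : nat) z : R :=
  \prod_(h < H | (h < k)%N) step_prob pi h z (z h).

Definition adapted (k : nat) (G : traj S A H -> R) : Prop :=
  forall z (h : 'I_H) y, (k <= h)%N -> G (upd z h y) = G z.

Lemma prefix_prob0 pi z : prefix_prob pi 0 z = 1.
Proof. by rewrite /prefix_prob big1. Qed.

Lemma prefix_prob_all pi z : prefix_prob pi H z = traj_prob M pi z.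
Proof.
by rewrite /prefix_prob /traj_prob; apply: eq_bigl => h; rewrite ltn_ord.
Qed.

Lemma prefix_probS pi (k : 'I_H) z :
  prefix_prob pi k.+1 z = prefix_prob pi k z * step_prob pi k z (z k).
Proof.
rewrite /prefix_prob (bigD1 k) ?ltnSn //= mulrC; congr (_ * _).
apply: eq_bigl => h; rewrite ltnS andbC ltn_neqAle; congr (_ && _).
Qed.

Lemma step_prob_upd pi (h k : 'I_H) z y y' : (h <= k)%N ->
  step_prob pi h (upd z k y) y' = step_prob pi h z y'.
Proof.
move=> hk; rewrite /step_prob; case: ifPn => // h0; rewrite upd_other //.
apply: contraTneq hk => <-; rewrite -ltnNge ord_pred_val ?lt0n //.
by rewrite prednK ?lt0n.
Qed.

Lemma prefix_prob_upd pi (k : 'I_H) z y :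
  prefix_prob pi k (upd z k y) = prefix_prob pi k z.
Proof.
apply: eq_bigr => h hk; rewrite step_prob_upd ?upd_other // 1?ltnW //.
by apply: contraTneq hk => ->; rewrite ltnn.
Qed.

Section Policy.
Variable pi : policy R S A H.
Hypothesis pi_dist : stochastic_policy pi.

Lemma step_prob_ge0 h z y : 0 <= step_prob pi h z y.
Proof.
rewrite mulr_ge0 //; last by case: (pi_dist h y.1).
by case: ifP => // _; case: (trans_dist M (ord_pred h) (z (ord_pred h))).
Qed.

Lemma step_prob_sum h z : \sum_y step_prob pi h z y = 1.
Proof.
pose k s := if h == 0%N :> nat then (s == init M)%:R
  else trans M (ord_pred h) (z (ord_pred h)) s.
transitivity (\sum_s \sum_a k s * pi h s a).
  by rewrite pair_big; apply: eq_bigr => -[].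
have -> : \sum_s \sum_a k s * pi h s a = \sum_s k s.
  apply: eq_bigr => s _; rewrite -mulr_sumr.
  by case: (pi_dist h s) => _ ->; rewrite mulr1.
rewrite /k; case: (h == 0%N :> nat); last by case: (trans_dist M (ord_pred h) (z (ord_pred h))).
rewrite (bigD1 (init M)) //= eqxx big1 ?addr0 // => s si.
by rewrite (negbTE si).
Qed.

Lemma traj_prob_ge0 z : 0 <= traj_prob M pi z.
Proof. by rewrite -prefix_prob_all prodr_ge0 // => h _; apply: step_prob_ge0. Qed.

Let N : R := #|{: S * A}|%:R.

(** Prefixes are represented by full trajectories, so each of the [j] free later stages is counted
    [N] times on the right; the factor on the left compensates. *)
Lemma prefix_marginal k j (G : traj S A H -> R) : (k + j)%N = H -> adapted k G ->
  N ^+ j * \sum_z traj_prob M pi z * G z = \sum_z prefix_prob pi k z * G z.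
Proof.
elim: j k G => [|j IH] k G.
  rewrite addn0 => -> _; rewrite expr0 mul1r.
  by apply: eq_bigr => z _; rewrite prefix_prob_all.
move=> kj aG; have kH : (k < H)%N by rewrite -kj addnS ltnS leq_addr.
rewrite exprS -mulrA (IH k.+1); first last.
- by move=> z h y kh; rewrite aG // ltnW.
- by rewrite addSnnS.
rewrite -/N -(sum_upd (Ordinal kH)); apply: eq_bigr => z _.
transitivity (\sum_y prefix_prob pi k z * G z * step_prob pi (Ordinal kH) z y).
  apply: eq_bigr => y _; rewrite (prefix_probS pi (Ordinal kH)) prefix_prob_upd.
  by rewrite step_prob_upd // upd_at aG //= mulrAC.
by rewrite -mulr_sumr step_prob_sum mulr1.
Qed.

Hypothesis SA_gt0 : (0 < #|{: S * A}|)%N.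

Let N0 : N != 0. Proof. by rewrite pnatr_eq0 -lt0n. Qed.

Lemma traj_prob_sum : \sum_z traj_prob M pi z = 1.
Proof.
apply: (mulfI (expf_neq0 H N0)).
have := @prefix_marginal 0 H (fun=> 1) (add0n H) (fun _ _ _ _ => erefl).
under eq_bigr do rewrite mulr1.
under [in RHS]eq_bigr do rewrite prefix_prob0 mulr1.
move=> ->; rewrite big_const iter_addr_0 card_ffun card_ord.
by rewrite mulr1 natrX.
Qed.

Lemma traj_prob_dist : is_dist (traj_prob M pi).
Proof. by split; [exact: traj_prob_ge0 | exact: traj_prob_sum]. Qed.

(** Conditioning on the stages before [h]: both sides are reduced to sums against the prefix
    probability, one of length [h], the other of length [h + 1] with its last stage summed out. *)
Lemma mean_traj_step (h : 'I_H) (G : traj S A H -> R) : adapted h.+1 G ->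
  mean (traj_prob M pi) G =
  mean (traj_prob M pi) (fun z => \sum_y step_prob pi h z y * G (upd z h y)).
Proof.
move=> aG; apply: (mulfI (expf_neq0 (H - h) N0)).
rewrite /mean [RHS](@prefix_marginal h); first last.
- move=> z j y hj; apply: eq_bigr => y' _; rewrite step_prob_upd //.
  congr (_ * _); case: (eqVneq j h) => [->|jh].
    by congr G; apply/ffunP => i; rewrite !ffunE; case: eqP.
  have -> : upd (upd z j y) h y' = upd (upd z h y') j y.
    apply/ffunP => i; rewrite !ffunE; case: (eqVneq i h) => // ->.
    by rewrite eq_sym (negbTE jh).
  by rewrite aG // ltn_neqAle hj eq_sym andbT; apply: contra jh => /eqP/val_inj ->.
- by rewrite subnKC // ltnW.
rewrite -(subnSK (ltn_ord h)) exprS -mulrA (@prefix_marginal h.+1) //; last first.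
  by rewrite subnKC.
rewrite -(sum_upd h); apply: eq_bigr => z _; rewrite mulr_sumr.
apply: eq_bigr => y _; rewrite prefix_probS prefix_prob_upd step_prob_upd //.
by rewrite upd_at mulrA.
Qed.

Definition next_mean (h : 'I_H) (x : S * A) (F : S * A -> R) : R :=
  mean (trans M h x) (fun s => mean (pi (ordS h) s) (fun a => F (s, a))).

Lemma mean_traj_next (h : 'I_H) (F : S * A -> S * A -> R) : (h.+1 < H)%N ->
  mean (traj_prob M pi) (fun z => F (z h) (z (ordS h))) =
  mean (traj_prob M pi) (fun z => next_mean h (z h) (F (z h))).
Proof.
move=> hH; have hS := ordS_val hH.
have hne : h != ordS h.
  by apply/eqP => hE; have := ltnSn h; rewrite -[X in (_ < X)%N]hS -hE ltnn.
rewrite (@mean_traj_step (ordS h)); last first.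
  move=> z j y; rewrite hS => hj.
  have jS : ordS h != j by apply: contraTneq hj => <-; rewrite hS ltnn.
  have jh : h != j by apply: contraTneq hj => <-; rewrite -leqNgt leqnSn.
  by rewrite !upd_other.
apply: eq_bigr => z _; congr (_ * _); rewrite /next_mean /mean.
transitivity (\sum_s \sum_a step_prob pi (ordS h) z (s, a) * F (z h) (s, a)).
  rewrite pair_big; apply: eq_bigr => -[s a] _ /=.
  by rewrite upd_at upd_other.
apply: eq_bigr => s _; rewrite mulr_sumr; apply: eq_bigr => a _.
by rewrite /step_prob hS /= ordSK mulrA.
Qed.

Lemma mean_traj_init (h0 : 'I_H) (F : S * A -> R) : h0 = 0%N :> nat ->
  mean (traj_prob M pi) (fun z => F (z h0)) =
  mean (pi h0 (init M)) (fun a => F (init M, a)).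
Proof.
move=> h00; rewrite (@mean_traj_step h0); last first.
  by move=> z j y; rewrite h00 => hj; rewrite upd_other // -(inj_eq val_inj) /= h00 neq_ltn hj.
rewrite -[RHS](mean_cst _ traj_prob_dist); apply: eq_bigr => z _; congr (_ * _).
transitivity (\sum_s \sum_a step_prob pi h0 z (s, a) * F (s, a)).
  by rewrite pair_big; apply: eq_bigr => -[s a] _; rewrite upd_at.
rewrite (bigD1 (init M)) //= [X in _ + X]big1 ?addr0; last first.
  move=> s /negbTE si; rewrite big1 // => a _.
  by rewrite /step_prob h00 /= si !mul0r.
by apply: eq_bigr => a _; rewrite /step_prob h00 /= eqxx mul1r.
Qed.

(** The action value of [pi], indexed by the number [k] of later stages so that it unfolds in step
    with [ucb_Q_rec]. *)
Fixpoint pol_Q r (k : nat) (h : 'I_H) (x : S * A) : R :=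
  r (h, x) + (if k is k'.+1 then next_mean h x (pol_Q r k' (ordS h)) else 0).

Lemma ret_stages r z : mean r (traj_loss R z) = \sum_(h < H) r (h, z h).
Proof.
transitivity (\sum_(h < H) \sum_x r (h, x) * (z h == x)%:R).
  by rewrite pair_bigA; apply: eq_bigr => -[h x].
apply: eq_bigr => h _; rewrite (bigD1 (z h)) //= eqxx mulr1 big1 ?addr0 // => x.
by rewrite eq_sym => /negbTE ->; rewrite mulr0.
Qed.

Lemma mean_ret_tail r k (h : 'I_H) : (h + k.+1)%N = H ->
  mean (traj_prob M pi) (fun z => \sum_(j < H | (h <= j)%N) r (j, z j)) =
  mean (traj_prob M pi) (fun z => pol_Q r k h (z h)).
Proof.
elim: k h => [|k IH] h hk.
  apply: eq_bigr => z _; congr (_ * _).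
  rewrite (bigD1 h) //= big1 // => j /andP[hj]; rewrite -(inj_eq val_inj) /=.
  by rewrite neq_ltn ltnNge hj /= ltnNge -ltnS -(addn1 h) hk ltn_ord.
have hH : (h.+1 < H)%N by rewrite -[X in (_ < X)%N]hk !addnS !ltnS leq_addr.
transitivity (mean (traj_prob M pi) (fun z => r (h, z h) +
    \sum_(j < H | (ordS h <= j)%N) r (j, z j))).
  apply: eq_bigr => z _; congr (_ * _); rewrite (bigD1 h) //; congr (_ + _).
  apply: eq_bigl => j; rewrite (ordS_val hH) ltn_neqAle andbC; congr (_ && _).
  by rewrite eq_sym.
rewrite meanD IH; last by rewrite ordS_val // addSnnS.
by rewrite (@mean_traj_next h (fun _ => pol_Q r k (ordS h))) // -meanD.
Qed.

Lemma mean_ret r k (h0 : 'I_H) : h0 = 0%N :> nat -> k.+1 = H ->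
  mean (traj_prob M pi) (fun z => mean r (traj_loss R z)) =
  mean (pi h0 (init M)) (fun a => pol_Q r k h0 (init M, a)).
Proof.
move=> h00 kH; rewrite -(mean_traj_init (fun x => pol_Q r k h0 x) h00).
rewrite -mean_ret_tail ?h00 //.
apply: eq_bigr => z _; congr (_ * _); rewrite ret_stages.
exact: eq_bigl.
Qed.

Lemma mean_visit r :
  mean (traj_prob M pi) (fun z => mean r (traj_loss R z)) = mean r (visit M pi).
Proof.
rewrite /mean; under eq_bigr do rewrite mulr_sumr.
rewrite exchange_big /=; apply: eq_bigr => x _.
rewrite /visit [in RHS]big_mkcond mulr_sumr; apply: eq_bigr => z _.
by rewrite /traj_loss; case: eqP; rewrite ?mulr1 ?mulr0 // mulrC.
Qed.

Lemma visit_ge0 x : 0 <= visit M pi x.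
Proof. by apply: sumr_ge0 => z _; apply: traj_prob_ge0. Qed.

Lemma visit_le1 x : visit M pi x <= 1.
Proof.
rewrite -traj_prob_sum /visit big_mkcond; apply: ler_sum => z _.
by case: ifP => // _; apply: traj_prob_ge0.
Qed.

End Policy.

Lemma det_policy_dist (f : 'I_H -> S -> A) : stochastic_policy (det_policy R f).
Proof.
move=> h s; split=> [a|]; first by rewrite /det_policy.
rewrite (bigD1 (f h s)) //= /det_policy eqxx big1 ?addr0 // => a /negbTE ->.
by [].
Qed.

Lemma mean_det_policy (f : 'I_H -> S -> A) h s (F : A -> R) :
  mean (det_policy R f h s) F = F (f h s).
Proof.
rewrite /mean (bigD1 (f h s)) //= /det_policy eqxx mul1r big1 ?addr0 // => a /negbTE ->.
by rewrite mul0r.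
Qed.

End Trajectories.

(** * Optimism and width of UCBVI *)

(* The variance term is absorbed by the telescoping of the squares [y ^+ 2],
   which is what spares a factor H. *)
Lemma optimism_step (R : realType) (y v v2 r b : R) :
  0 <= y <= 1 -> 0 <= v <= 1 -> 0 <= r -> 0 <= b -> 0 <= v2 - v ^+ 2 ->
  y <= r + v + 4^-1 * (v2 - v ^+ 2) + 41 * b ->
  y + y ^+ 2 / 2 <= 2 * r + 82 * b + (v + v2 / 2).
Proof.
move=> /andP[y0 y1] /andP[v0 v1] r0 b0 q0 h.
have : y ^+ 2 - v ^+ 2 <= 2 * (r + 4^-1 * (v2 - v ^+ 2) + 41 * b).
  have -> : y ^+ 2 - v ^+ 2 = (y - v) * (y + v) by ring.
  have [yv|yv] := leP y v.
    apply: (@le_trans _ _ 0); last by lra.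
    by rewrite mulr_le0_ge0 ?subr_le0 ?addr_ge0.
  apply: (@le_trans _ _ ((y - v) * 2)); last by lra.
  by rewrite ler_wpM2l ?subr_ge0 ?ltW //; lra.
lra.
Qed.

Section Optimism.
Variables (R : realType) (S A : finType) (H : nat).
Variable M : mdp R S A H.
Variables (dl : R) (w : seq (traj S A H)) (r : triple S A H -> R).

Lemma emp_trans_dist (x : triple S A H) : (0 < visits w x)%N ->
  is_dist (emp_trans R w x).
Proof.
move=> n0; split=> [s|]; first by rewrite /emp_trans divr_ge0.
rewrite /emp_trans -mulr_suml -natr_sum.
have -> : (\sum_s count (fun z : traj S A H =>
    (z x.1 == x.2) && ((z (ordS x.1)).1 == s)) w)%N = visits w x.
  rewrite /visits; elim: w => [|z u IH] /=; first by rewrite big1.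
  rewrite big_split /= IH; congr (_ + _)%N.
  rewrite (bigD1 (z (ordS x.1)).1) //= eqxx andbT big1 ?addn0 // => s.
  by rewrite eq_sym => /negbTE ->; rewrite andbF.
by rewrite divff // pnatr_eq0 -lt0n.
Qed.

Hypotheses (r0 : forall x, 0 <= r x) (r1 : \sum_x r x <= 1).

Definition width (x : triple S A H) : R :=
  if visits w x == 0%N then 1
  else Num.min 1 (beta S A H (visits w x) dl / (visits w x)%:R).

(** Unvisited triples are left out because their empirical frequencies are 0 / 0 and do not form a
    distribution; the last stage because no value function follows it. *)
Definition concentrated : Prop :=
  forall (h : 'I_H) (x : S * A), (h.+1 < H)%N -> (0 < visits w (h, x))%N ->
  entropy_le (trans M h x) (emp_trans R w (h, x))
    (beta S A H (visits w (h, x)) dl / (visits w (h, x))%:R).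

Hypothesis beta_gt0 : forall n, 0 < beta S A H n dl.
Hypothesis conc : concentrated.

Let Q := ucb_Q_rec dl w r.
Let V k h s := \big[Num.max/0]_a Q k h (s, a).

Lemma width_ge0 x : 0 <= width x.
Proof.
rewrite /width; case: ifP => // _.
by rewrite le_min ler01 divr_ge0 // ltW // beta_gt0.
Qed.

Lemma width_le1 x : width x <= 1.
Proof. by rewrite /width; case: ifP => // _; rewrite ge_min lexx. Qed.

Lemma reward_le1 x : r x <= 1.
Proof.
apply: le_trans r1; rewrite (bigD1 x) //= lerDl.
by apply: sumr_ge0.
Qed.

Lemma bonusE x f : bonus dl w x f =
  bern_bonus (emp_trans R w x) (beta S A H (visits w x) dl / (visits w x)%:R) f.
Proof. by rewrite /bonus /bern_bonus !mulrA. Qed.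

Lemma bonus_ge0 x f : 0 <= bonus dl w x f.
Proof. by rewrite /bonus le_max sqrtr_ge0. Qed.

Lemma ucb_QS k h x : Q k.+1 h x =
  if visits w (h, x) == 0%N then 1
  else Num.min (r (h, x) + mean (emp_trans R w (h, x)) (V k (ordS h))
                + bonus dl w (h, x) (V k (ordS h))) 1.
Proof. by []. Qed.

Lemma ucb_V_ge0 k h s : 0 <= V k h s.
Proof. exact: bigmax_ge_id. Qed.

Lemma ucb_Q_ge0 k h x : 0 <= Q k h x.
Proof.
case: k => [|k]; first exact: r0.
rewrite ucb_QS.
case: ifP => [_|/negbT n0]; first exact: ler01.
rewrite le_min ler01 andbT !addr_ge0 ?bonus_ge0 //.
apply: mean_ge0 => [|s]; first by apply: emp_trans_dist; rewrite lt0n.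
exact: ucb_V_ge0.
Qed.

Lemma ucb_Q_le1 k h x : Q k h x <= 1.
Proof.
case: k => [|k]; first exact: reward_le1.
by rewrite ucb_QS; case: ifP => // _; rewrite ge_min lexx orbT.
Qed.

Lemma ucb_V01 k h s : 0 <= V k h s <= 1.
Proof.
rewrite ucb_V_ge0 /=; apply: bigmax_le => // a _.
exact: ucb_Q_le1.
Qed.

Lemma kappa_gt0 x : (0 < visits w x)%N ->
  0 < beta S A H (visits w x) dl / (visits w x)%:R.
Proof. by move=> n0; rewrite divr_gt0 ?ltr0n. Qed.

(** The bound by 1 is not inductive, since each stage adds a reward. Bounding the return from stage
    [h] by the total reward mass at stages from [h] on is. *)
Lemma pol_Q_le_tail pi k (h : 'I_H) x : stochastic_policy pi -> (h + k.+1)%N = H ->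
  pol_Q M pi r k h x <= \sum_(y : triple S A H | (h <= y.1)%N) r y.
Proof.
move=> dpi; elim: k h x => [|k IH] h x hk.
  rewrite /= addr0 (bigD1 (h, x)) //= lerDl.
  exact: sumr_ge0.
have hH : (h.+1 < H)%N by rewrite -[X in (_ < X)%N]hk !addnS !ltnS leq_addr.
have sH := ordS_val hH.
apply: (@le_trans _ _ (r (h, x) + \sum_(y : triple S A H | (ordS h <= y.1)%N) r y)).
  rewrite lerD2l /next_mean.
  have dp := trans_dist M h x.
  rewrite -[leRHS](mean_cst _ dp); apply: ler_mean => // s.
  rewrite -[leRHS](mean_cst _ (dpi (ordS h) s)); apply: ler_mean => // a.
  by apply: IH; rewrite sH addSnnS.
rewrite sH [leRHS](bigD1 (h, x)) //= lerD2l.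
apply: le_trans (_ : \sum_(y : triple S A H | (h < y.1)%N) r y <= _) => //.
rewrite big_mkcond [leRHS]big_mkcond /=; apply: ler_sum => -[j y] _ /=.
case: ltnP => [hj|_]; last by case: ifP.
by rewrite ltnW //= ifT // xpair_eqE negb_and -(inj_eq val_inj) /= gtn_eqF.
Qed.

Lemma pol_Q_le1 pi k (h : 'I_H) x : stochastic_policy pi -> (h + k.+1)%N = H ->
  pol_Q M pi r k h x <= 1.
Proof.
move=> dpi hk; apply: le_trans (pol_Q_le_tail x dpi hk) _.
apply: le_trans r1; rewrite big_mkcond /=; apply: ler_sum => y _.
by case: ifP.
Qed.

(** Clipping at 1 is harmless because the total reward is at most 1. The comparison is made with
    every stochastic policy, so no optimal policy has to be constructed. *)
Lemma ucb_Q_optimistic pi k (h : 'I_H) x : stochastic_policy pi -> (h + k.+1)%N = H ->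
  pol_Q M pi r k h x <= Q k h x.
Proof.
move=> dpi; elim: k h x => [|k IH] h x hk; first by rewrite /= addr0.
have hH : (h.+1 < H)%N by rewrite -[X in (_ < X)%N]hk !addnS !ltnS leq_addr.
have hk' : (ordS h + k.+1)%N = H by rewrite ordS_val // addSnnS.
rewrite ucb_QS; case: ifP => [_|/negbT n0]; first exact: pol_Q_le1.
rewrite le_min (pol_Q_le1 _ dpi hk) andbT /= -addrA lerD2l.
have dp := trans_dist M h x.
have n1 : (0 < visits w (h, x))%N by rewrite lt0n.
apply: (@le_trans _ _ (mean (trans M h x) (V k (ordS h)))).
  apply: ler_mean => // s; rewrite -[leRHS](mean_cst _ (dpi (ordS h) s)).
  apply: ler_mean => // a; apply: le_trans (IH _ _ hk') _.
  exact: (le_bigmax _ (fun b => Q k (ordS h) (s, b))).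
have := bern_bonus_valid dp (emp_trans_dist n1) (conc hH n1) (kappa_gt0 n1)
  (ucb_V01 k (ordS h)).
by rewrite -bonusE distrC ler_norml => /andP[_]; rewrite lerBlDl.
Qed.

(** The induction carries y + y^2/2 rather than y. The mean of the square under the next-state law
    exceeds the square of the mean by the variance, which pays for the variance term of the bonus at
    the current stage. *)
Lemma ucb_value_le (f : 'I_H -> S -> A) k (h : 'I_H) s : ucbvi_plays dl w r f ->
  (h + k.+1)%N = H ->
  Q k h (s, f h s) + Q k h (s, f h s) ^+ 2 / 2 <=
    pol_Q M (det_policy R f) (fun x => 2 * r x + 82 * width x) k h (s, f h s).
Proof.
move=> plf; have VE (j : 'I_H) l t : (j + l.+1)%N = H -> V l j t = Q l j (t, f j t).
  move=> jl; apply/eqP; rewrite eq_le; apply/andP; split; last first.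
    exact: (le_bigmax _ (fun a => Q l j (t, a))).
  apply: bigmax_le => [|a _]; first exact: ucb_Q_ge0.
  have := plf j t a; rewrite /ucb_Q.
  by have -> : (H - j.+1 = l)%N by rewrite -[X in (X - _)%N]jl addnS subSS addKn.
elim: k h s => [|k IH] h s hk; set y := Q _ h _.
  have y0 : 0 <= y by exact: r0.
  have y1 : y <= 1 by exact: reward_le1.
  have b0 := width_ge0 (h, (s, f h s)).
  rewrite /= addr0 -[r _]/y; nra.
have hH : (h.+1 < H)%N by rewrite -[X in (_ < X)%N]hk !addnS !ltnS leq_addr.
have hk' : (ordS h + k.+1)%N = H by rewrite ordS_val // addSnnS.
set x := (s, f h s) in y *; pose p := trans M h x.
have dp : is_dist p by exact: trans_dist.
pose U := V k (ordS h).
have U01 := ucb_V01 k (ordS h).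
apply: (@le_trans _ _ (2 * r (h, x) + 82 * width (h, x) +
    (mean p U + mean p (fun t => U t ^+ 2) / 2))); last first.
  rewrite /= lerD2l /next_mean mulrC -meanZ -meanD; apply: ler_mean => // t.
  by rewrite mean_det_policy /U VE // mulrC; exact: IH.
have q0 := var_ge0 U dp; rewrite varE // in q0.
apply: optimism_step => //; first by rewrite ucb_Q_ge0 ucb_Q_le1.
- exact: mean01.
- exact: width_ge0.
have y1 : y <= 1 by exact: ucb_Q_le1.
have m0 : 0 <= mean p U by case/andP: (mean01 dp U01).
have rx0 := r0 (h, x).
(* Whenever the width equals 1, for an unvisited triple or a large [b], the term 41 * 1 alone
   exceeds [y]. *)
rewrite /width; case: ifPn => n0; first by lra.
have n1 : (0 < visits w (h, x))%N by rewrite lt0n.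
set b := beta _ _ _ _ _ / _.
have [b1|b1] := leP 1 b; first by lra.
have := emp_mean_bonus_le dp (emp_trans_dist n1) (conc hH n1) (kappa_gt0 n1) U01.
rewrite -bonusE varE // -/p -/b => hb.
have : y <= r (h, x) + (mean (emp_trans R w (h, x)) U + bonus dl w (h, x) U).
  by rewrite /y ucb_QS (negbTE n0) ge_min addrA lexx.
by move=> /le_trans; apply; rewrite -!addrA lerD2l !addrA.
Qed.

End Optimism.

(** * Supermartingales on histories *)

(* Induction on [\sum_s k s]: the multinomial probability of [k] is the
   [q]-average of those of the [k - 1_s]. *)
Lemma multinomial_le1 (R : realType) (S : finType) (q : S -> R) (k : S -> nat) :
  is_dist q ->
  (\sum_s k s)`!%:R * \prod_s q s ^+ k s <= \prod_s (k s)`!%:R :> R.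
Proof.
move=> [q0 q1]; move: {2}(\sum_s k s)%N (erefl (\sum_s k s)%N) => n.
elim: n k => [|n IH] k kn.
  have k0 s : k s = 0%N.
    by apply/eqP; rewrite -leqn0 -kn (bigD1 s) //= leq_addr.
  by rewrite kn !big1 ?mulr1 // => s _; rewrite k0.
have le_s s : (k s)%:R * ((n.+1)`!%:R * \prod_t q t ^+ k t) <=
    n.+1%:R * \prod_t (k t)`!%:R * q s.
  have [ks|ks] := posnP (k s).
    rewrite ks mul0r mulr_ge0 // mulr_ge0 //.
    by apply: prodr_ge0.
  pose k' t := (k t - (t == s))%N.
  have k's : (k s = (k' s).+1)%N by rewrite /k' eqxx subn1 prednK.
  have k't t : t != s -> k' t = k t by rewrite /k' => /negbTE ->; rewrite subn0.
  have k'n : (\sum_t k' t)%N = n.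
    apply/eqP; rewrite -eqSS -kn (bigD1 s) // [in X in _ == X](bigD1 s) //=.
    by rewrite k's addSn; apply/eqP; congr (_ + _).+1%N; apply: eq_bigr => t /k't.
  have Eq : \prod_t q t ^+ k t = q s * \prod_t q t ^+ k' t.
    rewrite (bigD1 s) // [in RHS](bigD1 s) //= k's exprS -mulrA; congr (_ * (_ * _)).
    by apply: eq_bigr => t /k't ->.
  have Ef : \prod_t (k t)`!%:R = (k s)%:R * \prod_t (k' t)`!%:R :> R.
    rewrite (bigD1 s) // [in RHS](bigD1 s) //= k's factS natrM -mulrA.
    by congr (_ * (_ * _)); apply: eq_bigr => t /k't ->.
  rewrite Eq Ef factS natrM.
  have := IH _ k'n; rewrite k'n => le_n.
  have -> : (k s)%:R * (n.+1%:R * n`!%:R * (q s * \prod_t q t ^+ k' t)) =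
    (k s)%:R * n.+1%:R * q s * (n`!%:R * \prod_t q t ^+ k' t) by ring.
  apply: (@le_trans _ _ ((k s)%:R * n.+1%:R * q s * \prod_t (k' t)`!%:R)).
    by rewrite ler_wpM2l // !mulr_ge0.
  by rewrite le_eqVlt; apply/orP; left; apply/eqP; ring.
have : \sum_s (k s)%:R * ((n.+1)`!%:R * \prod_t q t ^+ k t) <=
    \sum_s n.+1%:R * \prod_t (k t)`!%:R * q s.
  by apply: ler_sum => s _.
rewrite -mulr_suml -natr_sum kn -mulr_sumr q1 mulr1.
by rewrite ler_pM2l ?ltr0n.
Qed.

Definition rising (s n : nat) : nat := \prod_(i < n) (s + i).

Lemma rising_shift s n : (rising s.+1 n * s = rising s n * (s + n))%N.
Proof.
elim: n => [|n IH]; first by rewrite /rising !big_ord0 addn0 mulnC.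
rewrite /rising !big_ord_recr /= -!/(rising _ _) mulnAC IH.
by rewrite addSnnS.
Qed.

(** Divided by n!, the left side is the binomial coefficient of n + s over s, the number of count
    vectors with s + 1 entries and sum n. Each unit of [s] multiplies it by at most n + 1. *)
Lemma rising_le s n : (rising s.+1 n <= n`! * n.+1 ^ s)%N.
Proof.
elim: s => [|s IH].
  rewrite expn0 muln1 fact_prod big_add1 big_mkord /rising.
  exact: leq_prod.
rewrite -(leq_pmul2r (ltn0Sn s)) rising_shift.
apply: (@leq_trans (n`! * n.+1 ^ s * (s.+1 + n))); first by rewrite leq_mul2r IH orbT.
rewrite expnS [(n.+1 * _)%N]mulnC mulnA -[leqRHS]mulnA leq_mul2l; apply/orP; right.
by rewrite mulSn leq_add2l leq_pmulr.
Qed.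

Section Martingales.
Variables (R : realType) (S A : finType) (H : nat).
Variable M : mdp R S A H.
Implicit Types (w u : seq (traj S A H)) (x : triple S A H).

Definition succ_state x (z : traj S A H) : S := (z (ordS x.1)).1.

Definition trans_count w x s : nat :=
  count (fun z : traj S A H => (z x.1 == x.2) && (succ_state x z == s)) w.

Lemma trans_count_sum w x : (\sum_s trans_count w x s)%N = visits w x.
Proof.
rewrite /trans_count /visits; elim: w => [|z u IH] /=; first by rewrite big1.
rewrite big_split /= IH; congr (_ + _)%N.
rewrite (bigD1 (succ_state x z)) //= eqxx andbT big1 ?addn0 // => s.
by rewrite eq_sym => /negbTE ->; rewrite andbF.
Qed.

Definition laplace w x s : R :=
  (trans_count w x s).+1%:R / (visits w x + #|S|)%:R.

Lemma S_gt0 : (0 < #|S|)%N.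
Proof. by apply/card_gt0P; exists (init M). Qed.

Lemma laplace_ge0 w x s : 0 <= laplace w x s.
Proof. by rewrite divr_ge0. Qed.

Lemma laplace_sum w x : \sum_s laplace w x s = 1.
Proof.
rewrite /laplace -mulr_suml -natr_sum.
have -> : (\sum_s (trans_count w x s).+1)%N = (visits w x + #|S|)%N.
  rewrite -trans_count_sum -sum1_card -big_split /=.
  by apply: eq_bigr => s _; rewrite addn1.
by rewrite divff // pnatr_eq0 -lt0n addn_gt0 S_gt0 orbT.
Qed.

(* Likelihood ratio of Laplace's estimator against the true kernel.  On an
   impossible transition the junk value 1 / 0 = 0 makes it vanish, whence the
   assumption [trans_pos] below. *)
Fixpoint trans_mart x w : R :=
  if w is z :: u then
    trans_mart x u *
    (if z x.1 == x.2 then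
       laplace u x (succ_state x z) / trans M x.1 x.2 (succ_state x z)
     else 1)
  else 1.

Lemma trans_ge0 h y s : 0 <= trans M h y s.
Proof. by case: (trans_dist M h y). Qed.

Lemma trans_mart_ge0 x w : 0 <= trans_mart x w.
Proof.
elim: w => //= z u IH; rewrite mulr_ge0 //; case: ifP => // _.
by rewrite divr_ge0 ?laplace_ge0 ?trans_ge0.
Qed.

(** When the triple is visited, the true kernel cancels against the denominator and leaves the total
    mass of Laplace's estimator. States of zero true probability lose their share, whence an
    inequality and not an equality. *)
Lemma trans_mart_super x u pi : stochastic_policy pi ->
  (0 < #|{: S * A}|)%N -> (x.1.+1 < H)%N ->
  mean (traj_prob M pi) (fun z => trans_mart x (z :: u)) <= trans_mart x u.
Proof.
move=> dpi SA0 xH; rewrite /= meanZ -[leRHS]mulr1 ler_wpM2l ?trans_mart_ge0 //.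
pose F (y y' : S * A) :=
  if y == x.2 then laplace u x y'.1 / trans M x.1 x.2 y'.1 else 1.
rewrite -[X in mean _ X]/(fun z : traj S A H => F (z x.1) (z (ordS x.1))).
rewrite mean_traj_next //; apply: mean_le1; first exact: traj_prob_dist.
move=> z; rewrite /next_mean /F; case: eqP => [->|_]; last first.
  apply: mean_le1 => [|s]; first exact: trans_dist.
  by apply: mean_le1 => //; exact: dpi.
rewrite -(laplace_sum u x); apply: ler_sum => s _.
rewrite /= (mean_cst _ (dpi (ordS x.1) s)).
have [->|p0] := eqVneq (trans M x.1 x.2 s) 0; first by rewrite mul0r laplace_ge0.
by rewrite mulrC divfK.
Qed.

Definition trans_pos x w : bool :=
  all (fun z : traj S A H =>
         (z x.1 == x.2) ==> (0 < trans M x.1 x.2 (succ_state x z))) w.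

Lemma traj_prob_trans_pos x pi z : (x.1.+1 < H)%N ->
  traj_prob M pi z != 0 ->
  (z x.1 == x.2) ==> (0 < trans M x.1 x.2 (succ_state x z)).
Proof.
move=> xH; rewrite /traj_prob (bigD1 (ordS x.1)) //= mulf_eq0 negb_or.
rewrite mulf_eq0 negb_or => /andP[/andP[+ _] _].
rewrite ordSK (modn_small xH) /= => t0.
by apply/implyP => /eqP <-; rewrite lt_neqAle eq_sym t0 trans_ge0.
Qed.

Lemma trans_count_cons x z u s : trans_count (z :: u) x s =
  (((z x.1 == x.2) && (succ_state x z == s)) + trans_count u x s)%N.
Proof. by []. Qed.

Lemma prod_count_cons (F : nat -> S -> R) x (z : traj S A H) u : z x.1 = x.2 ->
  \prod_s F (trans_count (z :: u) x s) s =
  F (trans_count u x (succ_state x z)).+1 (succ_state x z) *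
  \prod_(s | s != succ_state x z) F (trans_count u x s) s.
Proof.
move=> zx; rewrite (bigD1 (succ_state x z)) //=; congr (_ * _).
  by rewrite zx !eqxx.
by apply: eq_bigr => s; rewrite zx eq_sym => /negbTE ->; rewrite eqxx.
Qed.

Lemma visits_cons x z u :
  visits (z :: u) x = ((z x.1 == x.2) + visits u x)%N.
Proof. by []. Qed.

Lemma trans_mart_cons x z u : trans_mart x (z :: u) = trans_mart x u *
  (if z x.1 == x.2 then
     laplace u x (succ_state x z) / trans M x.1 x.2 (succ_state x z) else 1).
Proof. by []. Qed.

(** The successive Laplace estimates multiply to a quotient of factorials that depends on the counts
    only, not on their order. *)
Lemma trans_martE x w : trans_pos x w ->
  trans_mart x w * \prod_s trans M x.1 x.2 s ^+ trans_count w x s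
    * (rising #|S| (visits w x))%:R =
  \prod_s (trans_count w x s)`!%:R.
Proof.
elim: w => [_|z u IH].
  by rewrite /rising big_ord0 !big1 ?mulr1.
move=> /andP[zp /IH {}IH]; rewrite trans_mart_cons visits_cons.
have [zx|zx] := eqVneq (z x.1) x.2; last first.
  have E s : trans_count (z :: u) x s = trans_count u x s.
    by rewrite trans_count_cons (negbTE zx).
  rewrite mulr1 add0n; under eq_bigr do rewrite E.
  by under [RHS]eq_bigr do rewrite E.
set s0 := succ_state x z in zp *.
have p0 : 0 < trans M x.1 x.2 s0 by move: zp; rewrite zx eqxx.
rewrite (prod_count_cons (fun k s => trans M x.1 x.2 s ^+ k) u zx).
rewrite (prod_count_cons (fun k _ => k`!%:R) u zx) -/s0 add1n.
move: IH; rewrite (bigD1 s0) //= [in RHS](bigD1 s0) //= -/s0.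
rewrite /laplace /rising big_ord_recr /= -/(rising _ _) factS natrM exprS.
rewrite [(#|S| + _)%N]addnC natrM.
set a := trans_mart x u; set P := \prod_(s | _) _; set Q := \prod_(s | _) _.
set N := (visits u x + #|S|)%:R => IH.
have N0 : N != 0 by rewrite pnatr_eq0 -lt0n addn_gt0 S_gt0 orbT.
rewrite -[RHS]mulrA -IH; field.
by rewrite -natrD N0 gt_eqF.
Qed.

(** The multinomial bound is applied to the exponential tilt [q] of the true kernel by [g]. The
    powers of the true kernel cancel against those in [trans_martE], leaving exp(n * mean g) <= L
    (n+1)^S W^n; taking logarithms gives the bound for every [g]. *)
Lemma entropy_le_of_mart x w (L : R) : trans_pos x w -> (0 < visits w x)%N ->
  trans_mart x w <= L ->
  entropy_le (trans M x.1 x.2) (emp_trans R w x)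
    ((ln L + #|S|%:R * ln (visits w x).+1%:R) / (visits w x)%:R).
Proof.
move=> wpos n0 ML g; set n := visits w x in n0 *.
set p := trans M x.1 x.2; pose W := mean p (fun s => expR (g s)).
have dp : is_dist p by exact: trans_dist.
have W0 : 0 < W.
  rewrite lt_neqAle eq_sym; apply/andP; split; last first.
    by apply: mean_ge0 => // s; exact: expR_ge0.
  apply/negP => /eqP W0; have [p0 p1] := dp.
  have pz s : p s = 0.
    have := @psumr_eq0P R S xpredT (fun s => p s * expR (g s)).
    move=> /(_ (fun s _ => mulr_ge0 (p0 s) (expR_ge0 _)) W0 s isT) /eqP.
    by rewrite mulf_eq0 expR_eq0 orbF => /eqP.
  by move: p1; rewrite big1 // => /eqP; rewrite eq_sym oner_eq0.
pose q s := p s * expR (g s) / W.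
have dq : is_dist q.
  split=> [s|]; last by rewrite /q -mulr_suml divff ?gt_eqF.
  by rewrite /q divr_ge0 ?(ltW W0) // mulr_ge0 ?expR_ge0; case: dp.
set k := trans_count w x.
have kn : (\sum_s k s)%N = n by exact: trans_count_sum.
set P := \prod_s p s ^+ k s.
(* The cancellation below divides by [P]; this is where [trans_pos] is needed. *)
have P0 : 0 < P.
  apply: prodr_gt0 => s _; have [->|ks] := posnP (k s); first by rewrite expr0.
  rewrite exprn_gt0 //; move: ks; rewrite -has_count => /hasP[z zw /andP[zx /eqP <-]].
  by have /allP/(_ z zw) := wpos; rewrite zx.
have Eq : \prod_s q s ^+ k s = P * (expR (n%:R * mean (emp_trans R w x) g) / W ^+ n).
  rewrite /q; under eq_bigr do rewrite exprMn exprVn exprMn.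
  rewrite big_split /= big_split /= -mulrA; congr (_ * (_ * _)).
    under eq_bigr do rewrite -expRM_natr.
    rewrite -expR_sum; congr expR.
    rewrite /mean mulr_sumr; apply: eq_bigr => s _.
    rewrite /emp_trans mulrA [X in X * g s]mulrC divfK 1?mulrC //.
    by rewrite pnatr_eq0 -lt0n.
  by rewrite prodfV prodrXr kn.
have := multinomial_le1 k dq; rewrite kn Eq.
have := trans_martE wpos; rewrite -/k -/p -/P -/n => <-.
set m := trans_mart x w in ML *; set E := expR _; move=> h1.
have h2 : n`!%:R * (E / W ^+ n) <= m * (rising #|S| n)%:R.
  have -> : n`!%:R * (E / W ^+ n) = n`!%:R * (P * (E / W ^+ n)) / P.
    by field; rewrite !gt_eqF // exprn_gt0.
  by rewrite ler_pdivrMr // (mulrAC m _ P).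
have h3 : E <= L * n.+1%:R ^+ #|S| * W ^+ n.
  rewrite -ler_pdivrMr ?exprn_gt0 // -(ler_pM2l (_ : 0 < n`!%:R)); last first.
    by rewrite ltr0n fact_gt0.
  apply: le_trans h2 _; rewrite mulrCA.
  have L0 : 0 <= L by apply: le_trans ML; exact: trans_mart_ge0.
  apply: ler_pM => //; first exact: trans_mart_ge0.
  rewrite -natrX -natrM ler_nat.
  (* [rising_le] gives the exponent #|S| - 1, which is relaxed to #|S|. *)
  case: #|S| S_gt0 => // s _; apply: leq_trans (rising_le s n) _.
  by rewrite leq_mul2l leq_exp2l // ?leqnSn ?orbT.
have L0 : 0 < L.
  rewrite ltNge; apply/negP => L0; have := expR_gt0 (n%:R * mean (emp_trans R w x) g).
  rewrite -/E ltNge => /negP; apply; apply: le_trans h3 _.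
  by rewrite mulr_le0_ge0 ?exprn_ge0 ?(ltW W0) // mulr_le0_ge0 // exprn_ge0.
have n0R : 0 < n%:R :> R by rewrite ltr0n.
have h4 : n%:R * mean (emp_trans R w x) g <=
    ln L + #|S|%:R * ln n.+1%:R + n%:R * ln W.
  rewrite -[leLHS]expRK -/E.
  apply: le_trans (_ : ln (L * n.+1%:R ^+ #|S| * W ^+ n) <= _).
    by rewrite ler_ln ?posrE ?expR_gt0 // !mulr_gt0 ?exprn_gt0 // ltr0n.
  rewrite !lnM ?posrE ?mulr_gt0 ?exprn_gt0 ?ltr0n // !lnXn ?ltr0n //.
  by rewrite !mulr_natl.
rewrite -/W -(ler_pM2l n0R) mulrDr [X in _ + X]mulrC divfK ?gt_eqF //.
by rewrite addrC.
Qed.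

Fixpoint psum (F : seq (traj S A H) -> traj S A H -> R) w : R :=
  if w is z :: u then psum F u + F u z else 0.

(** On [0,1], exp(-y) <= 1/(1+y) <= 1 - y/2. Averaging gives 1 - mu/2 <= exp(-mu/2). Halving the
    conditional mean is what removes any variance term. *)
Lemma mean_exp_super (p Y : traj S A H -> R) : is_dist p ->
  (forall z, 0 <= Y z <= 1) ->
  mean p (fun z => expR (mean p Y / 2 - Y z)) <= 1.
Proof.
move=> dp Y01; set mu := mean p Y.
have -> : mean p (fun z => expR (mu / 2 - Y z)) =
    expR (mu / 2) * mean p (fun z => expR (- Y z)).
  by rewrite -meanZ; apply: eq_bigr => z _; rewrite expRD.
have : mean p (fun z => expR (- Y z)) <= 1 - mu / 2.
  have -> : 1 - mu / 2 = mean p (fun z => 1 + (- 2^-1) * Y z).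
    by rewrite meanD meanZ mean_cst // -/mu; lra.
  apply: ler_mean => // z; have /andP[y0 y1] := Y01 z.
  rewrite expRN; have y10 : 0 < 1 + Y z by lra.
  apply: (@le_trans _ _ (1 + Y z)^-1).
    by rewrite lef_pV2 ?posrE ?expR_gt0 ?expR_ge1Dx.
  rewrite -[leLHS]mul1r ler_pdivrMr //; nra.
have e0 := expR_gt0 (mu / 2).
move=> h; apply: le_trans (_ : expR (mu / 2) * (1 - mu / 2) <= _).
  by rewrite ler_pM2l.
have := expR_ge1Dx (- (mu / 2)); rewrite expRN => h'.
by rewrite mulrC -ler_pdivlMr // mul1r.
Qed.

Definition exp_mart (p : seq (traj S A H) -> traj S A H -> R)
    (Y : seq (traj S A H) -> traj S A H -> R) w : R :=
  expR (psum (fun u z => mean (p u) (Y u) / 2 - Y u z) w).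

Lemma exp_mart_super p Y u : is_dist (p u) -> (forall z, 0 <= Y u z <= 1) ->
  mean (p u) (fun z => exp_mart p Y (z :: u)) <= exp_mart p Y u.
Proof.
move=> dp Y01; rewrite /exp_mart /=.
have -> : mean (p u) (fun z => expR (psum (fun u z => mean (p u) (Y u) / 2 - Y u z) u
     + (mean (p u) (Y u) / 2 - Y u z))) =
   expR (psum (fun u z => mean (p u) (Y u) / 2 - Y u z) u) *
   mean (p u) (fun z => expR (mean (p u) (Y u) / 2 - Y u z)).
  by rewrite -meanZ; apply: eq_bigr => z _; rewrite expRD.
by rewrite -[leRHS]mulr1 ler_pM2l ?expR_gt0 // mean_exp_super.
Qed.

End Martingales.

(** * Ville's inequality *)

Section Ville.
Variables (R : realType) (S A : finType) (H : nat).
Variables (d : measure_display) (T : measurableType d) (P : probability T R).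
Variables (M : mdp R S A H) (c : triple S A H -> R) (delta : R).
Variables (pol : seq (traj S A H) -> 'I_H -> S -> A) (X : nat -> T -> traj S A H).
Hypothesis run : covgame_run P M c delta pol X.
Hypothesis SA_gt0 : (0 < #|{: S * A}|)%N.

Let tp u := traj_prob M (det_policy R (pol u)).

Lemma tp_dist u : is_dist (tp u).
Proof. by apply: traj_prob_dist => //; exact: det_policy_dist. Qed.

(** [Q] is arbitrary because there are finitely many trajectories: the event splits according to the
    latest one, and the induction is over all predicates. *)
Lemma hist_measurable t (Q : seq (traj S A H) -> Prop) :
  measurable [set w | Q (hist X t w)].
Proof.
elim: t Q => [|t IH] Q /=.
  have [q|q] := pselect (Q [::]).
    by rewrite (_ : [set _ | _] = setT) //; apply/seteqP; split.
  by rewrite (_ : [set _ | _] = set0) //; apply/seteqP; split.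
rewrite (_ : [set _ | _] = \bigcup_(z in [set: traj S A H])
    ([set w | X t w = z] `&` [set w | Q (z :: hist X t w)])).
  apply: fin_bigcup_measurable => [|z _]; first exact: finite_finset.
  apply: measurableI; first exact: (run_meas run).
  exact: (IH (fun u => Q (z :: u))).
apply/seteqP; split => w /=; first by move=> q; exists (X t w).
by move=> [z _ [<-]].
Qed.

Lemma measure_bigsetU_le (I : Type) (s : seq I) (F : I -> set T) :
  (forall i, measurable (F i)) ->
  (P (\big[setU/set0]_(i <- s) F i) <= \sum_(i <- s) P (F i))%E.
Proof.
move=> mF; elim: s => [|i s IH]; first by rewrite !big_nil measure0.
rewrite !big_cons; apply: le_trans (measureU2 _ (mF i) _) _.
  by apply: bigsetU_measurable.
by rewrite leeD2l.
Qed.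

Lemma in_bigsetU (I : eqType) (s : seq I) (F : I -> set T) i w :
  i \in s -> F i w -> (\big[setU/set0]_(i <- s) F i) w.
Proof.
elim: s => // j s IH; rewrite inE big_cons => /orP[/eqP <-|si] Fw; first by left.
by right; apply: IH.
Qed.

Section Crossing.
Variables (m : seq (traj S A H) -> R) (a : R).
Hypotheses (m0 : forall u, 0 <= m u) (a0 : 0 < a).
Hypothesis m_super : forall u, ~~ covered c u ->
  mean (tp u) (fun z => m (z :: u)) <= m u.

(** The event that [m] reaches [a] at some time from [t] to [t + n], without passing through a
    covered history first. Recursion on the remaining horizon replaces a stopped process and
    respects the fact that the law of the run is only known on uncovered histories. *)
Fixpoint crosses (n t : nat) (w : T) : Prop :=
  a <= m (hist X t w) \/
  (if n is n'.+1 then ~~ covered c (hist X t w) /\ crosses n' t.+1 w else False).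

Lemma crosses_measurable n t : measurable [set w | crosses n t w].
Proof.
elim: n t => [|n IH] t.
  exact: (hist_measurable t (fun u => a <= m u \/ False)).
rewrite (_ : [set _ | _] = [set w | a <= m (hist X t w)] `|`
    ([set w | ~~ covered c (hist X t w)] `&` [set w | crosses n t.+1 w])) //.
apply: measurableU; first exact: (hist_measurable t (fun u => a <= m u)).
apply: measurableI => //; exact: (hist_measurable t (fun u => ~~ covered c u)).
Qed.

Let hist_eq t u := [set w | hist X t w = u].

Lemma hist_crosses_measurable n t u :
  measurable (hist_eq t u `&` [set w | crosses n t w]).
Proof.
apply: measurableI; last exact: crosses_measurable.
exact: (hist_measurable t (fun v => v = u)).
Qed.

(** Ville's inequality started from the history [u]. If [m u] is already at least [a] the factor is
    at least 1; otherwise a crossing must occur after one more episode, and the supermartingale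
    property averages the bounds over the next trajectory. *)
Lemma prob_crosses n t u : size u = t ->
  (P (hist_eq t u `&` [set w | crosses n t w]) <= P (hist_eq t u) * (m u / a)%:E)%E.
Proof.
elim: n t u => [|n IH] t u tu.
all: have [am|ma] := leP a (m u).
1,3: apply: (@le_trans _ _ (P (hist_eq t u))).
1,3: apply: le_measure; rewrite ?inE; [exact: hist_crosses_measurable
  | exact: (hist_measurable t (fun v => v = u)) | exact: subIsetl].
1,2: by rewrite -[leLHS]mule1 lee_pmul // lee_fin ler_pdivlMr // mul1r.
all: have q0 : (0 <= P (hist_eq t u) * (m u / a)%:E)%E
  by rewrite mule_ge0 // lee_fin divr_ge0 // ltW.
  rewrite (_ : _ `&` _ = set0) ?measure0 //; apply/seteqP; split => // w [/= ->].
  by rewrite leNgt ma => -[].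
have [cu|cu] := boolP (covered c u).
  rewrite (_ : _ `&` _ = set0) ?measure0 //; apply/seteqP; split => // w [/= ->].
  by rewrite leNgt ma cu => -[|[]].
apply: (@le_trans _ _ (P (\big[setU/set0]_(z <- index_enum _)
    (hist_eq t.+1 (z :: u) `&` [set w | crosses n t.+1 w])))).
  apply: le_measure; rewrite ?inE.
  - exact: hist_crosses_measurable.
  - by apply: bigsetU_measurable => z _; exact: hist_crosses_measurable.
  move=> w [/= wu]; rewrite wu leNgt ma => -[//|[_ hw]].
  apply: (@in_bigsetU _ _ _ (X t w)); first exact: mem_index_enum.
  by split => //=; rewrite /hist_eq /= wu.
apply: le_trans (measure_bigsetU_le _ _) _.
  by move=> z; exact: hist_crosses_measurable.
apply: (@le_trans _ _ (\sum_(z : traj S A H)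
    P (hist_eq t u) * (tp u z * (m (z :: u) / a))%:E)%E).
  apply: lee_sum => z _; apply: le_trans (IH t.+1 (z :: u) _) _.
    by rewrite /= tu.
  by rewrite (run_law run) // -muleA -EFinM.
rewrite -ge0_sume_distrr; last first.
  move=> z _; rewrite lee_fin mulr_ge0 ?divr_ge0 ?(ltW a0) //.
  by case: (tp_dist u).
rewrite sumEFin; apply: lee_wpmul2l => //; rewrite lee_fin.
under eq_bigr do rewrite mulrA.
by rewrite -mulr_suml ler_pM2r ?invr_gt0 //; exact: m_super.
Qed.

Lemma prob_crosses0 n : (P [set w | crosses n 0 w] <= (m [::] / a)%:E)%E.
Proof.
have := @prob_crosses n 0 [::] erefl.
rewrite (_ : hist_eq 0 [::] = setT); last by apply/seteqP; split.
by rewrite setTI probability_setT mul1e.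
Qed.

Lemma not_crosses n t w : ~ crosses n t w -> forall j, (j <= n)%N ->
  (forall i, (i < j)%N -> ~~ covered c (hist X (t + i) w)) ->
  m (hist X (t + j) w) < a.
Proof.
elim: n t => [|n IH] t ncr [|j] // jn unc.
- by rewrite addn0 ltNge; apply/negP => am; apply: ncr; left.
- by rewrite addn0 ltNge; apply/negP => am; apply: ncr; left.
rewrite addnS -addSn; apply: IH => // [cr|i ij].
  apply: ncr; right; split=> //.
  by have := unc 0%N isT; rewrite addn0.
by rewrite addSn -addnS; apply: unc.
Qed.

End Crossing.

Fixpoint possible (u : seq (traj S A H)) : bool :=
  if u is z :: v then possible v && (tp v z != 0) else true.

Lemma ville_inequality (m : seq (traj S A H) -> R) (a : R) n :
  (forall u, 0 <= m u) -> 0 < a ->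
  (forall u, ~~ covered c u -> mean (tp u) (fun z => m (z :: u)) <= m u) ->
  exists2 B : set T, measurable B & (P B <= (m [::] / a)%:E)%E /\
  forall w, ~ B w -> forall j, (j <= n)%N ->
    (forall i, (i < j)%N -> ~~ covered c (hist X i w)) ->
    possible (hist X j w) /\ m (hist X j w) < a.
Proof.
(* Freezing [m] at [a] on histories of probability zero preserves the
   supermartingale property, so that these never occur outside [B]. *)
move=> m0 a0 m_super; pose m' u := if possible u then m u else a.
have m'0 u : 0 <= m' u by rewrite /m'; case: ifP => // _; exact: ltW.
have m'_super u : ~~ covered c u -> mean (tp u) (fun z => m' (z :: u)) <= m' u.
  move=> cu; rewrite /m' /=; case: (possible u) => /=; last first.
    by rewrite mean_cst //; exact: tp_dist.
  apply: le_trans (m_super u cu); apply: ler_sum => z _.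
  by case: eqVneq => [->|_]; rewrite ?mul0r.
exists [set w | crosses m' a n 0 w]; first exact: crosses_measurable.
split; first exact: (prob_crosses0 m'0 a0 m'_super n).
move=> w ncr j jn unc; have := not_crosses ncr jn unc.
by rewrite add0n /m'; case: ifP => // _; rewrite ltxx.
Qed.

End Ville.

(** * Level sets and losses of the forecaster *)

(** The square root is at most (B + L)/2 by the arithmetic-geometric mean inequality, and half of
    [L] is then absorbed on the left. *)
Lemma self_bounded (R : realType) (B L a : R) : 0 <= B -> 0 <= L ->
  L - a <= Num.sqrt (B * L) + B -> L <= 2 * a + 3 * B.
Proof.
move=> B0 L0.
have : Num.sqrt (B * L) <= (B + L) / 2.
  have h4 : 0 <= (B + L) / 2 by rewrite divr_ge0 // addr_ge0.
  rewrite -[leRHS](ger0_norm h4) -sqrtr_sqr ler_wsqrtr //.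
  have := sqr_ge0 (B - L); lra.
lra.
Qed.

Section WMFLemmas.
Variables (R : realType) (T : finType) (D : {set T}).

Lemma exp_weights_simplex (eta : R) (L : T -> R) : (0 < #|D|)%N ->
  simplex D (exp_weights D eta L).
Proof.
move=> /card_gt0P[x0 x0D]; split; last first.
  by move=> x xD; rewrite /exp_weights (negbTE xD).
have W0 : 0 < \sum_(y in D) expR (- (eta * L y)).
  rewrite (bigD1 x0) //= ltr_wpDr ?expR_gt0 //.
  by apply: sumr_ge0 => y _; exact: expR_ge0.
split=> [x|].
  by rewrite /exp_weights; case: ifP => // _; rewrite divr_ge0 ?expR_ge0 // ltW.
by rewrite /exp_weights -big_mkcond /= -mulr_suml divff // gt_eqF.
Qed.

Fixpoint wmf_loss (ys : seq (T -> R)) : R :=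
  if ys is y :: ys' then wmf_loss ys' + mean (wmf D ys') y else 0.

Lemma wmf_loss_mkseq (y : nat -> T -> R) n :
  \sum_(t < n) mean (wmf D (rev (mkseq y t))) (y t) = wmf_loss (rev (mkseq y n)).
Proof.
elim: n => [|n IH]; first by rewrite big_ord0.
by rewrite big_ord_recr /= IH mkseqS rev_rcons.
Qed.

Lemma cumul_mkseq (y : nat -> T -> R) n x :
  \sum_(t < n) y t x = cumul (rev (mkseq y n)) x.
Proof.
rewrite /cumul; elim: n => [|n IH]; first by rewrite big_ord0 big_nil.
by rewrite big_ord_recr /= IH mkseqS rev_rcons big_cons addrC.
Qed.

(** Restates the guarantee on most-recent-first lists. The guarantee speaks of infinite loss
    sequences, so the list is padded with zero losses. *)
Lemma wmf_regret (B : R) (ys : seq (T -> R)) lambda : (0 < size ys)%N ->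
  regret_guarantee D (wmf D) B -> simplex D lambda ->
  (forall t x, 0 <= nth (fun=> 0) ys t x <= 1) ->
  wmf_loss ys - mean lambda (cumul ys) <= Num.sqrt (B * wmf_loss ys) + B.
Proof.
move=> ys0 reg dl ys01; pose y t := nth (fun=> 0) (rev ys) t.
have ymk : mkseq y (size ys) = rev ys by rewrite -(size_rev ys) mkseq_nth.
have y01 t x : 0 <= y t x <= 1.
  rewrite /y; have [ts|ts] := ltnP t (size ys).
    by rewrite nth_rev.
  by rewrite nth_default ?size_rev // lexx ler01.
have := reg y (size ys) y01 ys0 lambda dl.
rewrite wmf_loss_mkseq ymk revK.
suff -> : \sum_(t < size ys) mean lambda (y t) = mean lambda (cumul ys) by [].
rewrite /mean exchange_big /=; apply: eq_bigr => x _.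
by rewrite -mulr_sumr cumul_mkseq ymk revK.
Qed.

Lemma wmf_loss_ge0 (ys : seq (T -> R)) : (0 < #|D|)%N ->
  (forall t x, 0 <= nth (fun=> 0) ys t x <= 1) -> 0 <= wmf_loss ys.
Proof.
move=> D0; elim: ys => //= y ys IH ys01; rewrite addr_ge0 //.
  by apply: IH => t; exact: (ys01 t.+1).
apply: mean_ge0 => [|x]; last by case/andP: (ys01 0%N x).
by case: (exp_weights_simplex (wmf_rate D (wmf_var D ys)) (cumul ys) D0).
Qed.

End WMFLemmas.

Section Levels.
Variables (R : realType) (S A : finType) (H : nat).
Variable c : triple S A H -> R.
Hypothesis c_pos : exists x, 0 < c x.
Implicit Types (u w : seq (traj S A H)) (x : triple S A H) (k : nat).

Lemma cmin_ge1 : 1 <= cmin c.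
Proof. by rewrite /cmin le_max lexx orbT. Qed.

Lemma cmin_gt0 : 0 < cmin c.
Proof. exact: lt_le_trans cmin_ge1. Qed.

Lemma in_level_setS k x : (x \in level_set c k.+1) = (cmin c * 2 ^+ k.+1 < c x).
Proof. by rewrite inE. Qed.

Lemma in_supp x : (x \in supp c) = (0 < c x).
Proof. by rewrite inE. Qed.

Lemma level_set_anti k j : (k <= j)%N -> level_set c j \subset level_set c k.
Proof.
move=> kj; apply/fintype.subsetP => x; case: j kj => [|j]; first by rewrite leqn0 => /eqP ->.
rewrite in_level_setS => kj cx; case: k kj => [|k] kj.
  by rewrite [level_set _ _]/= in_supp; apply: lt_trans cx; rewrite mulr_gt0 ?cmin_gt0 ?exprn_gt0.
rewrite in_level_setS; apply: le_lt_trans cx.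
by rewrite ler_pM2l ?cmin_gt0 // ler_weXn2l // ler1n.
Qed.

Lemma level_set_supp k : level_set c k \subset supp c.
Proof. exact: (level_set_anti (leq0n k)). Qed.

(** A triple in X_k with k positive has 2^k below cmax / cmin, so k is below the ceiling of the
    binary logarithm; k = 0 is covered by the maximum with 1. *)
Lemma num_levels_nat : exists2 m : nat, num_levels c = m%:R &
  forall k, (0 < #|level_set c k|)%N -> (k < m)%N.
Proof.
rewrite /num_levels; set z := Num.ceil _.
have [m mE] : exists m : nat, Num.max (z%:~R : R) 1 = m%:R.
  have [z1|z1] := leP (z%:~R : R) 1; first by exists 1%N.
  have z0 : 0 <= z by rewrite -(ler0z R) ltW // (lt_trans ltr01).
  by exists `|z|%N; rewrite natr_absz ger0_norm.
exists m => // k /card_gt0P[x]; case: k => [|k] xk.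
  by rewrite -(ltr_nat R) -mE lt_max ltr01 orbT.
rewrite -(ltr_nat R) -mE lt_max; apply/orP; left.
apply: lt_le_trans (Num.Theory.ceil_ge _).
move: xk; rewrite in_level_setS => cx.
have c0 := cmin_gt0.
have xm : c x <= cmax c by exact: le_bigmax.
have l2 : 0 < ln 2 :> R by rewrite ln_gt0 // ltr1n.
rewrite ltr_pdivlMr // mulr_natl -lnXn //.
by rewrite ltr_ln ?posrE ?exprn_gt0 ?divr_gt0 ?ltr_pdivlMr //;
  rewrite 1?mulrC ?(lt_le_trans cx) // (lt_trans _ (lt_le_trans cx xm)) // mulr_gt0 ?exprn_gt0.
Qed.

(** Such a triple lies outside every X_k with k positive and has a positive target. Hence no
    positive level is done on the empty history, in agreement with the value 0 that [level] takes
    there. *)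
Lemma exists_le_cmin : exists2 x, x \in supp c & c x <= cmin c.
Proof.
apply: contrapT => nex.
have all_gt x : x \in supp c -> cmin c < c x.
  by move=> xs; rewrite ltNge; apply/negP => cx; apply: nex; exists x.
have [x0 x0p] := c_pos.
have : cmin c < \big[Num.min/cmax c]_(x in supp c) c x.
  apply/bigmin_gtP; split => //.
  by apply: lt_le_trans (all_gt x0 _) (le_bigmax _ _ _); rewrite in_supp.
by rewrite ltNge /cmin le_max lexx.
Qed.

Lemma uncovered_witness u : ~~ covered c u -> exists x, (visits u x)%:R < c x.
Proof. by rewrite negb_forall => /existsP[x]; rewrite -ltNge; exists x. Qed.

Lemma level_done0 u : level_done c u 0.
Proof. by apply/forallP => x; rewrite andbN. Qed.

Lemma level_done_nonempty u j : ~~ covered c u -> level_done c u j ->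
  (0 < #|level_set c j|)%N.
Proof.
move=> /uncovered_witness[x ux] /forallP/(_ x)/implyP uj.
apply/card_gt0P; exists x; apply: contraLR ux => xj; rewrite -leNgt.
have [xs|xs] := boolP (x \in supp c); first by apply: uj; rewrite xs.
by apply: le_trans (_ : 0 <= _) => //; rewrite leNgt -in_supp.
Qed.

Lemma level_spec u : ~~ covered c u ->
  level_done c u (level c u) /\ forall i, level_done c u i -> (i <= level c u)%N.
Proof.
move=> cu; case: u cu => [|z u] cu.
  split=> [|i]; first exact: level_done0.
  case: i => // i /forallP done; have [x xs cx] := exists_le_cmin.
  have := done x; rewrite xs in_level_setS -leNgt.
  have -> : c x <= cmin c * 2 ^+ i.+1.
    by apply: le_trans cx _; rewrite ler_peMr ?(ltW cmin_gt0) // exprn_ege1 // ler1n.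
  by rewrite leNgt -in_supp xs.
rewrite /level; apply: (@xgetPex nat 0%N [set j | level_done c (z :: u) j /\
  forall i, level_done c (z :: u) i -> (i <= j)%N]).
have [m _ mP] := num_levels_nat.
have ub i : level_done c (z :: u) i -> (i <= m)%N.
  by move=> /(level_done_nonempty cu) /mP /ltnW.
have ex : exists i, level_done c (z :: u) i by exists 0%N; exact: level_done0.
by case: (ex_maxnP ex ub) => j jd jmax; exists j.
Qed.

Lemma covered_cons z u : covered c u -> covered c (z :: u).
Proof.
move=> /forallP cu; apply/forallP => x; apply: le_trans (cu x) _.
by rewrite ler_nat visits_cons leq_addl.
Qed.

Lemma level_mono z u : ~~ covered c (z :: u) -> (level c u <= level c (z :: u))%N.
Proof.
move=> czu; have cu : ~~ covered c u by apply: contra czu; exact: covered_cons.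
have [/forallP du _] := level_spec cu; have [_] := level_spec czu; apply.
apply/forallP => x; apply/implyP => xk; have /implyP/(_ xk) := du x.
by move=> /le_trans; apply; rewrite ler_nat visits_cons leq_addl.
Qed.

Lemma level_nonempty u : ~~ covered c u -> (0 < #|level_set c (level c u)|)%N.
Proof. by move=> cu; exact: level_done_nonempty cu (proj1 (level_spec cu)). Qed.

(** Level k + 1 is not done, so some triple of the support outside X_(k+1) is still short of its
    target, which is at most cmin 2^(k+1). As level k is done, this triple lies in X_k. *)
Lemma level_witness u : ~~ covered c u -> exists2 x, x \in level_set c (level c u) &
  (visits u x)%:R < cmin c * 2 ^+ (level c u).+1.
Proof.
move=> cu; have [du dmax] := level_spec cu.
have : ~~ level_done c u (level c u).+1.
  by apply/negP => /dmax; rewrite ltnn.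
rewrite negb_forall => /existsP[x]; rewrite negb_imply -ltNge => /andP[/andP[xs xk] ux].
exists x; last by apply: lt_le_trans ux _; move: xk; rewrite in_level_setS -leNgt.
apply: contraLR ux => xk'; rewrite -leNgt.
by have /forallP/(_ x)/implyP := du; apply; rewrite xs.
Qed.

Lemma lambda_simplex u : ~~ covered c u ->
  simplex (level_set c (level c u)) (lambda_next c u).
Proof. by move=> cu; apply: exp_weights_simplex; exact: level_nonempty. Qed.

Definition phase_loss k w : R :=
  psum (fun u z => if level c u == k then mean (lambda_next c u) (traj_loss R z) else 0) w.

Lemma phase_loss_future k w : ~~ covered c w -> (level c w < k)%N -> phase_loss k w = 0.
Proof.
elim: w => //= z u IH czu lk; have lu := leq_ltn_trans (level_mono czu) lk.
rewrite /phase_loss /= -/(phase_loss k u) IH //; last first.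
  by apply: contra czu; exact: covered_cons.
by rewrite ltn_eqF // addr0.
Qed.

(** Levels never decrease, so the episodes at the current level are exactly those since the last
    reset, and these are the ones that [losses] keeps. *)
Lemma phase_loss_wmf w : ~~ covered c w ->
  phase_loss (level c w) w = wmf_loss (level_set c (level c w)) (losses c w).
Proof.
elim: w => // z u IH czu; have cu : ~~ covered c u.
  by apply: contra czu; exact: covered_cons.
have := level_mono czu; rewrite leq_eqVlt.
rewrite [losses c (z :: u)]/= eq_sym; case: eqVneq => [lE _|lN /= lu].
  by rewrite lE /phase_loss /= eqxx -/(phase_loss _ u) IH.
rewrite /phase_loss /= -/(phase_loss _ u) phase_loss_future //.
by rewrite ltn_eqF // addr0.
Qed.

Lemma losses01 w t x : 0 <= nth (fun=> 0) (losses c w) t x <= 1.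
Proof.
elim: w t => [|z u IH] t /=; first by rewrite nth_nil lexx ler01.
case: ifP => _; last by rewrite nth_nil lexx ler01.
by case: t => [|t] //=; rewrite /traj_loss ler0n lern1 leq_b1.
Qed.

Lemma cumul_losses w x : cumul (losses c w) x <= (visits w x)%:R.
Proof.
elim: w => [|z u IH]; first by rewrite /cumul big_nil.
rewrite visits_cons /=; case: ifP => _; last by rewrite /cumul big_nil.
by rewrite /cumul big_cons natrD lerD2l.
Qed.

Variable B : R.
Hypothesis B0 : 0 <= B.
Hypothesis regret : forall k, (0 < #|level_set c k|)%N ->
  regret_guarantee (level_set c k) (wmf (level_set c k)) B.

Definition phase_bound k : R := 2 * (cmin c * 2 ^+ k.+1 + 1) + 3 * B.

(** The comparator is the point mass at the triple of [level_witness]. If [z] ends the phase, its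
    loss is never fed to the forecaster; since the regret guarantee holds for any sequence of losses
    it can still be appended, at the price of the [+ 1] in [phase_bound]. *)
Lemma phase_loss_last z u : ~~ covered c u ->
  phase_loss (level c u) (z :: u) <= phase_bound (level c u).
Proof.
move=> cu; set k := level c u; have D0 := level_nonempty cu.
have E : phase_loss k (z :: u) =
    wmf_loss (level_set c k) (traj_loss R z :: losses c u).
  by rewrite /= -phase_loss_wmf // /phase_loss /= eqxx.
have [x xk ux] := level_witness cu.
pose lam y : R := (y == x)%:R.
have dl : simplex (level_set c k) lam.
  split; first split => [y|]; rewrite /lam //.
    by rewrite (bigD1 x) //= eqxx big1 ?addr0 // => y /negbTE ->.
  by move=> y; apply: contraNeq; rewrite pnatr_eq0 eqb0 negbK => /eqP ->.
have ys01 t y : 0 <= nth (fun=> 0) (traj_loss R z :: losses c u) t y <= 1.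
  case: t => [|t]; last exact: losses01.
  by rewrite /= /traj_loss ler0n lern1 leq_b1.
have := @wmf_regret _ _ _ B (traj_loss R z :: losses c u) lam isT (regret D0) dl ys01.
rewrite -E.
have -> : mean lam (cumul (traj_loss R z :: losses c u)) =
    cumul (traj_loss R z :: losses c u) x.
  rewrite /mean (bigD1 x) //= /lam eqxx mul1r big1 ?addr0 // => y /negbTE ->.
  by rewrite mul0r.
have h1 : cumul (traj_loss R z :: losses c u) x <= cmin c * 2 ^+ k.+1 + 1.
  rewrite /cumul big_cons addrC lerD //.
    by apply: le_trans (cumul_losses u x) (ltW ux).
  by rewrite /traj_loss lern1 leq_b1.
have h0 : 0 <= phase_loss k (z :: u) by rewrite E wmf_loss_ge0.
move=> h2; apply: self_bounded => //.
by apply: le_trans _ h2; rewrite lerD2l lerN2.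
Qed.

Lemma phase_bound_ge0 k : 0 <= phase_bound k.
Proof.
by rewrite /phase_bound addr_ge0 ?mulr_ge0 // addr_ge0 // mulr_ge0 ?exprn_ge0 // ltW // cmin_gt0.
Qed.

Lemma phase_loss_le k z u : ~~ covered c u -> phase_loss k (z :: u) <= phase_bound k.
Proof.
elim: u z => [|z' u IH] z cu.
  have [<-|lk] := eqVneq (level c [::]) k; first exact: phase_loss_last.
  rewrite /phase_loss [psum _ _]/= add0r (_ : 0 == k = false) ?phase_bound_ge0 //.
  exact: negbTE lk.
have [<-|lk] := eqVneq (level c (z' :: u)) k; first exact: phase_loss_last.
rewrite /phase_loss [psum _ _]/= -/(psum _ (z' :: u)) (negbTE lk) addr0.
by apply: IH; apply: contra cu; exact: covered_cons.
Qed.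

Lemma weighted_loss_le (g : nat -> R) m z u : ~~ covered c u ->
  (forall k, 0 <= g k) ->
  (forall k, (0 < #|level_set c k|)%N -> (k < m)%N) ->
  psum (fun v y => g (level c v) * mean (lambda_next c v) (traj_loss R y)) (z :: u)
  <= \sum_(k < m) g k * phase_bound k.
Proof.
move=> cu g0 mP.
have -> : psum (fun v y => g (level c v) * mean (lambda_next c v) (traj_loss R y))
    (z :: u) = \sum_(k < m) g k * phase_loss k (z :: u).
  have step v y : ~~ covered c v ->
      \sum_(k < m) g k * phase_loss k (y :: v) = \sum_(k < m) g k * phase_loss k v +
      g (level c v) * mean (lambda_next c v) (traj_loss R y).
    move=> cv; rewrite /phase_loss /=; under eq_bigr do rewrite mulrDr.
    rewrite big_split /=; congr (_ + _).
    have lm : (level c v < m)%N := mP _ (level_nonempty cv).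
    rewrite (bigD1 (Ordinal lm)) //= eqxx big1 ?addr0 // => k kl.
    by rewrite ifN ?mulr0 //; apply: contra kl => /eqP lk; apply/eqP/val_inj.
  rewrite step //= ; congr (_ + _); elim: u cu {step} (step) => [|y v IH] cu step.
    by rewrite big1 // => k _; rewrite mulr0.
  have cv : ~~ covered c v by apply: contra cu; exact: covered_cons.
  by rewrite step //= IH.
by apply: ler_sum => k _; rewrite ler_wpM2l // phase_loss_le.
Qed.

End Levels.

(** * Deterministic bound on the number of episodes *)

Lemma harmonic_sum_le (R : realType) n : (0 < n)%N ->
  \sum_(i < n) i.+1%:R^-1 <= 1 + ln n%:R :> R.
Proof.
elim: n => // -[|n] IH _; first by rewrite big_ord1 invr1 ln1 addr0.
rewrite big_ord_recr /=; apply: le_trans (lerD (IH isT) (lexx _)) _.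
rewrite -addrA lerD2l.
have n1 : 0 < n.+1%:R :> R by rewrite ltr0n.
have n2 : 0 < n.+2%:R :> R by rewrite ltr0n.
have h := @le_ln1Dx R (- n.+2%:R^-1).
have h1 : -1 < - n.+2%:R^-1 :> R.
  by rewrite ltrN2 invf_lt1 // ltr1n.
have := h h1.
have -> : 1 + - n.+2%:R^-1 = n.+1%:R / n.+2%:R :> R.
  apply: (mulIf (lt0r_neq0 n2)).
  by rewrite mulrDl mul1r mulNr mulVf ?gt_eqF // divfK ?gt_eqF // -[n.+2%:R]natr1 addrK.
by rewrite ln_div ?posrE // lerBlDr [_ + ln _]addrC lerBrDr.
Qed.

Section Core.
Variables (R : realType) (S A : finType) (H : nat).
Variables (M : mdp R S A H) (c : triple S A H -> R) (delta : R).
Variable pol : seq (traj S A H) -> 'I_H -> S -> A.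
Hypothesis c_pos : exists x, 0 < c x.
Hypothesis delta01 : 0 < delta < 1.
Hypothesis pol_plays : forall u, ~~ covered c u ->
  ucbvi_plays (delta / 2) u (lambda_next c u) (pol u).
Implicit Types (u v w : seq (traj S A H)) (z : traj S A H) (x : triple S A H).

Let delta_gt0 : 0 < delta. Proof. by case/andP: delta01. Qed.
Let delta_lt1 : delta < 1. Proof. by case/andP: delta01. Qed.

Let p u := traj_prob M (det_policy R (pol u)).

Lemma SA_gt0 : (0 < #|{: S * A}|)%N.
Proof. by have [x _] := c_pos; apply/card_gt0P; exists x.2. Qed.

Lemma A_gt0 : (0 < #|A|)%N.
Proof. by have [x _] := c_pos; apply/card_gt0P; exists x.2.2. Qed.

Lemma H_gt0 : (0 < H)%N.
Proof. by have [x _] := c_pos; apply: leq_ltn_trans (ltn_ord x.1). Qed.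

Lemma p_dist u : is_dist (p u).
Proof. by apply: traj_prob_dist SA_gt0; exact: det_policy_dist. Qed.

Let SAH : R := #|S|%:R * #|A|%:R * H%:R.

Lemma card_triple : #|{: triple S A H}|%:R = SAH.
Proof. by rewrite !card_prod card_ord !natrM /SAH mulrC. Qed.

Lemma SAH_ge1 : 1 <= SAH.
Proof.
rewrite -card_triple ler1n; have [x _] := c_pos.
by apply/card_gt0P; exists x.
Qed.

Lemma beta_half_gt0 n : 0 < beta S A H n (delta / 2).
Proof.
rewrite /beta; have := SAH_ge1; rewrite /SAH => N1.
apply: ltr_wpDr.
  rewrite mulr_ge0 // ln_ge0 // -natr1.
  have e1 : 1 <= expR 1 :> R by have := expR_ge1Dx (1 : R); lra.
  have n0 : 0 <= n%:R :> R by [].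
  nra.
rewrite ln_gt0 // -!mulrA [X in 2 * X](_ : _ = SAH / (delta / 2)); last first.
  by rewrite /SAH !mulrA.
rewrite mulrA ltr_pdivlMr ?divr_gt0 // mul1r.
rewrite /SAH; have := delta_lt1; lra.
Qed.

Lemma beta_le n k : (n <= k)%N -> beta S A H n (delta / 2) <= beta S A H k (delta / 2).
Proof.
move=> nk; rewrite /beta lerD2l ler_wpM2l // ler_ln ?posrE ?mulr_gt0 ?expR_gt0 ?ltr0n //.
by rewrite ler_pM2l ?mulr_gt0 ?expR_gt0 // ler_nat.
Qed.

Variables (piC pi1 : policy R S A H) (PhiC Phi1 : R).
Hypotheses (piC_dist : stochastic_policy piC) (pi1_dist : stochastic_policy pi1).
Hypotheses (PhiC0 : 0 < PhiC) (Phi10 : 0 < Phi1).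
Hypothesis coverC : forall x, x \in supp c -> c x <= PhiC * visit M piC x.
Hypothesis cover1 : forall x, x \in supp c -> 1 <= Phi1 * visit M pi1 x.

(* An upper bound on [phi_star] of the indicator of the k-th level set; the
   second case only arises when [k = 0] and some positive target is below 1. *)
Definition weight k : R :=
  if [forall x in level_set c k, cmin c * 2 ^+ k <= c x] then
    Num.min Phi1 (PhiC / (cmin c * 2 ^+ k))
  else Phi1.

Let threshold_gt0 k : 0 < cmin c * 2 ^+ k.
Proof. by rewrite mulr_gt0 ?cmin_gt0 ?exprn_gt0. Qed.

Lemma weight_ge0 k : 0 <= weight k.
Proof.
rewrite /weight; case: ifP => _; last exact: ltW.
by rewrite le_min (ltW Phi10) divr_ge0 // ltW // threshold_gt0.
Qed.

Lemma weight_le k : weight k <= Phi1.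
Proof. by rewrite /weight; case: ifP => // _; rewrite ge_min lexx. Qed.

Lemma weight_threshold k : weight k * (cmin c * 2 ^+ k) <= PhiC + Phi1.
Proof.
rewrite /weight; have t0 := threshold_gt0 k; case: ifP => [_|/negbT].
  apply: (@le_trans _ _ (PhiC / (cmin c * 2 ^+ k) * (cmin c * 2 ^+ k))).
    by rewrite ler_pM2r // ge_min lexx orbT.
  by rewrite divfK ?gt_eqF // lerDl ltW.
rewrite negb_forall => /existsP[x]; rewrite negb_imply -ltNge => /andP[xk].
case: k xk {t0} => [|k]; last by rewrite in_level_setS => /ltW h; rewrite ltNge h.
(* A positive target below [cmin] means that the maximum with 1 is active in [cmin], so the
   threshold of level 0 is at most 1. *)
rewrite expr0 mulr1 => xs cx; have : cmin c <= 1; last by have := PhiC0; have := Phi10; nra.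
move: cx; rewrite {1}/cmin lt_max ltNge /cmin => /orP[/negP[]|cx].
  by apply: (@bigmin_le_cond _ _ _ _ x).
rewrite ge_max lexx andbT; apply: le_trans (ltW cx).
by apply: bigmin_le_cond.
Qed.

(** One of the two covering policies visits every triple of X_k with probability at least the
    inverse of the weight, hence collects at least that much from any distribution on X_k the
    forecaster may choose. *)
Lemma weight_value k lam : simplex (level_set c k) lam ->
  exists2 pi, stochastic_policy pi & 1 <= weight k * mean lam (visit M pi).
Proof.
move=> [[l0 l1] lD].
have aux pi b : (forall x, x \in level_set c k -> 1 <= b * visit M pi x) ->
    1 <= b * mean lam (visit M pi).
  move=> bx; rewrite -l1 /mean mulr_sumr; apply: ler_sum => x _.
  rewrite mulrCA; have [xk|xk] := boolP (x \in level_set c k).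
    by rewrite ler_peMr // bx.
  by rewrite lD // !mul0r.
have sub := fintype.subsetP (level_set_supp c k).
rewrite /weight; case: ifP => [/forallP all_c|_]; last first.
  by exists pi1 => //; apply: aux => x xk; rewrite cover1 // sub.
rewrite minEle; case: ifP => _.
  by exists pi1 => //; apply: aux => x xk; rewrite cover1 // sub.
exists piC => //; apply: aux => x xk.
rewrite mulrAC ler_pdivlMr // mul1r; apply: le_trans (coverC (sub _ xk)).
by have /implyP := all_c x; apply.
Qed.

Definition gain u z : R := mean (lambda_next c u) (traj_loss R z).
Definition spread u z : R := mean (width (delta / 2) u) (traj_loss R z).

Lemma gain01 u z : ~~ covered c u -> 0 <= gain u z <= 1.
Proof.
move=> cu; have [dl _] := lambda_simplex c_pos cu.
apply: mean01 => // x; by rewrite /traj_loss ler0n lern1 leq_b1.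
Qed.

Lemma spread01 u z : 0 <= spread u z <= H%:R.
Proof.
rewrite /spread ret_stages; apply/andP; split.
  by apply: sumr_ge0 => h _; apply: width_ge0; exact: beta_half_gt0.
apply: le_trans (_ : \sum_(h < H) 1 <= _); last by rewrite sumr_const card_ord.
by apply: ler_sum => h _; exact: width_le1.
Qed.

Let Y1 u z := weight (level c u) / Phi1 * gain u z.
Let Y2 u z := H%:R^-1 * spread u z.

(** Below 1 / delta, each component is below 1 / delta divided by its weight. For a kernel this
    threshold is 4 SAH / delta, whose logarithm is exactly the first term of [beta] at confidence
    [delta / 2]. *)
Definition mixture u : R :=
  4^-1 * exp_mart p Y1 u + 4^-1 * exp_mart p Y2 u +
  (4 * SAH)^-1 * \sum_(x : triple S A H | (x.1.+1 < H)%N) trans_mart M x u.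

Let Y1_01 u z : ~~ covered c u -> 0 <= Y1 u z <= 1.
Proof.
move=> cu; have /andP[g0 g1] := gain01 z cu.
have w0 := weight_ge0 (level c u).
rewrite /Y1 mulr_ge0 ?divr_ge0 ?(ltW Phi10) //=.
by rewrite mulr_ile1 ?divr_ge0 ?(ltW Phi10) // ler_pdivrMr // mul1r weight_le.
Qed.

Let Y2_01 u z : 0 <= Y2 u z <= 1.
Proof.
have /andP[s0 s1] := spread01 u z.
by rewrite /Y2 mulr_ge0 ?invr_ge0 //= mulrC ler_pdivrMr ?ltr0n ?H_gt0 // mul1r.
Qed.

Let SAH0 : 0 < 4 * SAH.
Proof. by have := SAH_ge1; lra. Qed.

Lemma mixture_ge0 u : 0 <= mixture u.
Proof.
rewrite /mixture !addr_ge0 ?mulr_ge0 ?expR_ge0 ?invr_ge0 ?(ltW SAH0) //.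
by apply: sumr_ge0 => x _; exact: trans_mart_ge0.
Qed.

Lemma mixture_nil : mixture [::] <= 1.
Proof.
rewrite /mixture /exp_mart /= expR0.
have : \sum_(x : triple S A H | (x.1.+1 < H)%N) (1 : R) <= SAH.
  rewrite -card_triple -sumr_const big_mkcond; apply: ler_sum => x _.
  by case: ifP.
move=> h; have : (4 * SAH)^-1 * \sum_(x : triple S A H | (x.1.+1 < H)%N) (1 : R) <= 4^-1.
  rewrite mulrC ler_pdivrMr //; lra.
lra.
Qed.

Lemma mixture_super u : ~~ covered c u ->
  mean (p u) (fun z => mixture (z :: u)) <= mixture u.
Proof.
move=> cu; rewrite /mixture !meanD !meanZ.
have dp := p_dist u.
rewrite !lerD // ler_pM2l ?invr_gt0 //.
- by apply: exp_mart_super => // z; exact: Y1_01.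
- exact: exp_mart_super.
rewrite /mean; under eq_bigr do rewrite mulr_sumr.
rewrite exchange_big /=; apply: ler_sum => x xH.
by apply: trans_mart_super => //; [exact: det_policy_dist | exact: SA_gt0].
Qed.

Lemma possible_trans_pos x w : (x.1.+1 < H)%N -> possible M pol w -> trans_pos M x w.
Proof.
move=> xH; elim: w => //= z u IH /andP[/IH -> z0]; rewrite andbT.
exact: traj_prob_trans_pos z0.
Qed.

Lemma mixture_concentrated u : possible M pol u -> mixture u < delta^-1 ->
  concentrated M (delta / 2) u.
Proof.
move=> pu mu h y hH n0; set x := (h, y) in n0 *.
have xH : (x.1.+1 < H)%N by [].
have L : trans_mart M x u <= 4 * SAH / delta.
  have : (4 * SAH)^-1 * trans_mart M x u <= delta^-1.
    apply: ltW; apply: le_lt_trans mu; apply: (@le_trans _ _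
      ((4 * SAH)^-1 * \sum_(x : triple S A H | (x.1.+1 < H)%N) trans_mart M x u)).
      rewrite ler_pM2l ?invr_gt0 // (bigD1 x) //= lerDl.
      by apply: sumr_ge0 => t _; exact: trans_mart_ge0.
    by rewrite /mixture lerDr addr_ge0 // mulr_ge0 ?expR_ge0.
  by rewrite mulrC ler_pdivrMr // mulrC.
have ent := entropy_le_of_mart (possible_trans_pos xH pu) n0 L.
move=> g; apply: le_trans (ent g) _; rewrite lerD2l ler_pM2r ?invr_gt0 ?ltr0n //.
rewrite /beta; set n := visits u x; apply: lerD.
  rewrite le_eqVlt; apply/orP; left; apply/eqP; congr ln.
  by rewrite /SAH; field; rewrite gt_eqF.
rewrite ler_wpM2l // ler_ln ?posrE ?mulr_gt0 ?expR_gt0 ?ltr0n //.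
rewrite ler_peMl //; have := expR_ge1Dx (1 : R); lra.
Qed.

Lemma exp_mart_bound (Y : seq (traj S A H) -> traj S A H -> R) u :
  4^-1 * exp_mart p Y u <= delta^-1 ->
  psum (fun v z => mean (p v) (Y v) / 2 - Y v z) u <= ln (4 / delta).
Proof.
move=> h; rewrite -[leLHS]expRK ler_ln ?posrE ?expR_gt0 ?divr_gt0 //.
by move: h; rewrite mulrC ler_pdivrMr // mulrC.
Qed.

Lemma mixture_bounds u : mixture u < delta^-1 ->
  psum (fun v z => mean (p v) (Y1 v) / 2 - Y1 v z) u <= ln (4 / delta) /\
  psum (fun v z => mean (p v) (Y2 v) / 2 - Y2 v z) u <= ln (4 / delta).
Proof.
move=> /ltW mu.
have t0 : 0 <= (4 * SAH)^-1 * \sum_(x : triple S A H | (x.1.+1 < H)%N) trans_mart M x u.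
  rewrite mulr_ge0 ?invr_ge0 ?(ltW SAH0) //.
  by apply: sumr_ge0 => t _; exact: trans_mart_ge0.
have e1 : 0 <= exp_mart p Y1 u := expR_ge0 _.
have e2 : 0 <= exp_mart p Y2 u := expR_ge0 _.
by split; apply: exp_mart_bound; apply: le_trans mu; rewrite /mixture; lra.
Qed.

(** The value bound is multiplied by the weight of the current level. The gain keeps this weight,
    which must later meet the threshold of its own level; the widths only enter the lower-order term
    and can afford [Phi1]. *)
Lemma episode_bound u : ~~ covered c u -> concentrated M (delta / 2) u ->
  1 <= 2 * (weight (level c u) * mean (p u) (gain u)) +
       82 * Phi1 * mean (p u) (spread u).
Proof.
move=> cu conc; have sl := lambda_simplex c_pos cu.
have [[l0 l1] _] := sl.
have [pi dpi val1] := weight_value sl.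
have [k kH] : exists k, k.+1 = H by exists H.-1; rewrite prednK ?H_gt0.
pose h0 := Ordinal H_gt0; have h00 : h0 = 0%N :> nat by [].
have hk : (h0 + k.+1)%N = H by rewrite h00 add0n.
have l1' : \sum_x lambda_next c u x <= 1 by rewrite l1.
set f := pol u; pose y := ucb_Q_rec (delta / 2) u (lambda_next c u) k h0 (init M, f h0 (init M)).
have y_ge : mean (lambda_next c u) (visit M pi) <= y.
  rewrite -(mean_visit M pi) (mean_ret M dpi SA_gt0 _ h00 kH).
  rewrite -[leRHS](mean_cst _ (dpi h0 (init M))); apply: ler_mean => // a.
  apply: le_trans (ucb_Q_optimistic l0 l1' beta_half_gt0 conc _ dpi hk) _.
  have := pol_plays cu h0 (init M) a; rewrite /ucb_Q.
  by have -> : (H - h0.+1 = k)%N by rewrite h00 -kH subn1.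
have := ucb_value_le l0 l1' beta_half_gt0 conc (init M) (pol_plays cu) hk.
rewrite -/f -/y => y_le.
have df : stochastic_policy (det_policy R f) by exact: det_policy_dist.
pose r x := 2 * lambda_next c u x + 82 * width (delta / 2) u x.
have E : pol_Q M (det_policy R f) r k h0 (init M, f h0 (init M)) =
    2 * mean (p u) (gain u) + 82 * mean (p u) (spread u).
  rewrite -(mean_det_policy f h0 (init M)
    (fun a => pol_Q M (det_policy R f) r k h0 (init M, a))).
  rewrite -(mean_ret M df SA_gt0 _ h00 kH) -!meanZ -meanD; apply: eq_bigr => z _.
  congr (_ * _); rewrite /gain /spread /mean !mulr_sumr -big_split /=.
  by apply: eq_bigr => x _; rewrite /r; ring.
rewrite -/r E in y_le.
have w0 := weight_ge0 (level c u); have w1 := weight_le (level c u).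
have s0 : 0 <= mean (p u) (spread u).
  by apply: mean_ge0 => [|z]; [exact: p_dist | case/andP: (spread01 u z)].
apply: le_trans val1 _; apply: le_trans (ler_wpM2l w0 y_ge) _.
have y2 := sqr_ge0 y.
have : y <= 2 * mean (p u) (gain u) + 82 * mean (p u) (spread u) by lra.
move=> /(ler_wpM2l w0) /le_trans; apply.
have := ler_wpM2r s0 w1; lra.
Qed.

Lemma psumD F G w : psum (fun u z => F u z + G u z) w = psum F w + psum G w :> R.
Proof. by elim: w => [|z u IH] /=; rewrite ?addr0 // IH addrACA. Qed.

Lemma psumZ a F w : psum (fun u z => a * F u z) w = a * psum F w :> R.
Proof. by elim: w => [|z u IH] /=; rewrite ?mulr0 // IH mulrDr. Qed.

(** The conditions bear on the strict past of each episode, because its policy is computed from the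
    counts before it. *)
Fixpoint steady w : Prop :=
  if w is z :: u then
    [/\ steady u, ~~ covered c u & concentrated M (delta / 2) u]
  else True.

Lemma size_le_psum w : steady w ->
  (size w)%:R <= 2 * psum (fun u z => weight (level c u) * mean (p u) (gain u)) w +
    82 * Phi1 * psum (fun u z => mean (p u) (spread u)) w.
Proof.
elim: w => [_|z u IH] /=; first by rewrite !mulr0 addr0.
move=> [su cu conc]; have := episode_bound cu conc; have := IH su.
rewrite -natr1 !mulrDr; lra.
Qed.

Lemma gain_sum_le w : mixture w < delta^-1 ->
  psum (fun u z => weight (level c u) * mean (p u) (gain u)) w <=
  2 * psum (fun u z => weight (level c u) * gain u z) w + 2 * Phi1 * ln (4 / delta).
Proof.
move=> /mixture_bounds[+ _].
have -> : psum (fun v z => mean (p v) (Y1 v) / 2 - Y1 v z) w =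
    (2 * Phi1)^-1 * psum (fun u z => weight (level c u) * mean (p u) (gain u)) w
    + (- Phi1^-1) * psum (fun u z => weight (level c u) * gain u z) w.
  rewrite -!psumZ -psumD; elim: w => //= z u ->; congr (_ + (_ + _)).
    by rewrite [mean _ _]meanZ; field; rewrite gt_eqF.
  by rewrite /Y1; field; rewrite gt_eqF.
set a := psum _ w; set b := psum _ w; set l := ln _ => h.
have h2 : 2 * Phi1 * ((2 * Phi1)^-1 * a + - Phi1^-1 * b) <= 2 * Phi1 * l.
  by rewrite ler_pM2l // mulr_gt0.
have E : 2 * Phi1 * ((2 * Phi1)^-1 * a + - Phi1^-1 * b) = a - 2 * b.
  by field; rewrite gt_eqF.
rewrite E in h2; lra.
Qed.

Lemma spread_sum_le w : mixture w < delta^-1 ->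
  psum (fun u z => mean (p u) (spread u)) w <=
  2 * psum spread w + 2 * H%:R * ln (4 / delta).
Proof.
move=> /mixture_bounds[_ +].
have H0 : 0 < H%:R :> R by rewrite ltr0n H_gt0.
have -> : psum (fun v z => mean (p v) (Y2 v) / 2 - Y2 v z) w =
    (2 * H%:R)^-1 * psum (fun u z => mean (p u) (spread u)) w
    + (- H%:R^-1) * psum spread w.
  rewrite -!psumZ -psumD; elim: w => //= z u ->; congr (_ + (_ + _)).
    by rewrite [mean _ _]meanZ; field; rewrite gt_eqF.
  by rewrite /Y2 mulNr.
set a := psum _ w; set b := psum _ w; set l := ln _ => h.
have h2 : 2 * H%:R * ((2 * H%:R)^-1 * a + - H%:R^-1 * b) <= 2 * H%:R * l.
  by rewrite ler_pM2l // mulr_gt0.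
have E : 2 * H%:R * ((2 * H%:R)^-1 * a + - H%:R^-1 * b) = a - 2 * b.
  by field; rewrite gt_eqF.
rewrite E in h2; lra.
Qed.

Definition width_at (n : nat) : R :=
  if n == 0%N then 1 else Num.min 1 (beta S A H n (delta / 2) / n%:R).

(** Regrouping by triple: a visit that finds [n] earlier ones pays [width_at n]. *)
Lemma spread_sum_pigeonhole w :
  psum spread w <= \sum_(x : triple S A H) \sum_(n < visits w x) width_at n.
Proof.
elim: w => [|z u IH] /=.
  by apply: sumr_ge0 => x _; rewrite big_ord0.
apply: le_trans (lerD IH (lexx _)) _; rewrite /spread /mean -big_split /=.
apply: ler_sum => x _; rewrite /traj_loss; case: eqP => _ /=.
  by rewrite add1n big_ord_recr /= mulr1.
by rewrite add0n mulr0 addr0.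
Qed.

Lemma visits_le_size w x : (visits w x <= size w)%N.
Proof. exact: count_size. Qed.

Lemma width_at_sum_le n T : (n <= T)%N -> (0 < T)%N ->
  \sum_(i < n) width_at i <= 1 + beta S A H T (delta / 2) * (1 + ln T%:R).
Proof.
move=> nT T0; have b0 := beta_half_gt0 T.
have l0 : 0 <= ln T%:R :> R by rewrite ln_ge0 // ler1n.
case: n nT => [|n] nT; first by rewrite big_ord0 addr_ge0 // mulr_ge0 ?(ltW b0) // addr_ge0.
rewrite big_ord_recl lerD //.
case: n nT => [|n] nT; first by rewrite big_ord0 mulr_ge0 ?(ltW b0) // addr_ge0.
apply: (@le_trans _ _ (\sum_(i < n.+1) beta S A H T (delta / 2) * i.+1%:R^-1)).
  apply: ler_sum => i _; rewrite /width_at /= ge_min; apply/orP; right.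
  rewrite ler_pM2r ?invr_gt0 ?ltr0n // beta_le //.
  by apply: leq_trans nT; rewrite ltnW // ltnS ltn_ord.
rewrite -mulr_sumr ler_pM2l //; apply: le_trans (harmonic_sum_le R (ltn0Sn n)) _.
by rewrite lerD2l ler_ln ?posrE ?ltr0n // ler_nat ltnW.
Qed.

Lemma spread_sum_le_log w : (0 < size w)%N ->
  psum spread w <=
  SAH * (1 + beta S A H (size w) (delta / 2) * (1 + ln (size w)%:R)).
Proof.
move=> w0; apply: le_trans (spread_sum_pigeonhole w) _.
rewrite -card_triple mulr_natl -sumr_const; apply: ler_sum => x _.
by apply: width_at_sum_le => //; exact: visits_le_size.
Qed.

Variable B : R.
Hypothesis B0 : 0 <= B.
Hypothesis regret : forall k, (0 < #|level_set c k|)%N ->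
  regret_guarantee (level_set c k) (wmf (level_set c k)) B.
Variable m : nat.
Hypothesis m_levels : forall k, (0 < #|level_set c k|)%N -> (k < m)%N.

(** The constants: 16 = 2 * 2 * 4 and 24 + 12 B = 4 * (6 + 3 B) from the gains, 164 = 2 * 82 from
    the widths, and 168 = 164 + 4 since both passages to realized sums cost a multiple of ln(4 /
    delta). *)
Lemma steady_size_le w : (0 < size w)%N -> steady w -> mixture w < delta^-1 ->
  (size w)%:R <= 16 * m%:R * PhiC + m%:R * Phi1 * (24 + 12 * B)
    + 168 * Phi1 * H%:R * ln (4 / delta)
    + 164 * Phi1 * SAH *
      (1 + beta S A H (size w) (delta / 2) * (1 + ln (size w)%:R)).
Proof.
move=> w0 sw mw.
have h1 := size_le_psum sw; have h2 := gain_sum_le mw.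
have h3 := spread_sum_le mw; have h4 := spread_sum_le_log w0.
have h5 : psum (fun u z => weight (level c u) * gain u z) w <=
    m%:R * (4 * PhiC + Phi1 * (6 + 3 * B)).
  case: w w0 sw {mw h1 h2 h3 h4} => // z u _ [_ cu _].
  apply: le_trans (weighted_loss_le c_pos B0 regret z cu weight_ge0 m_levels) _.
  rewrite mulr_natl -[X in _ *+ X]card_ord -sumr_const; apply: ler_sum => k _.
  have t := weight_threshold k; have g0 := weight_ge0 k; have g1 := weight_le k.
  have := ler_wpM2r B0 g1.
  have -> : weight k * phase_bound c B k =
      4 * (weight k * (cmin c * 2 ^+ k)) + 2 * weight k + 3 * (weight k * B).
    by rewrite /phase_bound exprS; ring.
  lra.
have l0 : 0 <= ln (4 / delta).
  by rewrite ln_ge0 // ler_pdivlMr // mul1r; have := delta_lt1; lra.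
have H1 : 1 <= H%:R :> R by rewrite ler1n H_gt0.
have h6 : Phi1 * ln (4 / delta) <= Phi1 * H%:R * ln (4 / delta).
  by rewrite ler_wpM2r // ler_peMr // ltW.
have h7 := ler_wpM2l (ltW Phi10) h4; have h8 := ler_wpM2l (ltW Phi10) h3.
lra.
Qed.

End Core.

(** * Logarithmic factors *)

(* In the second case [T ^ (1/2) <= 50 Y l ^ 2], by [ln T <= 4 T ^ (1/4)]. *)
Lemma self_log_bounded (R : realType) (T x Y l : R) :
  1 <= T -> 0 < Y -> 1 <= l -> T <= x + Y * (l + ln T) ^+ 2 ->
  T <= 2 * x \/ T <= 2 * Y * (l + 2 * ln (50 * Y * l ^+ 2)) ^+ 2.
Proof.
move=> T1 Y0 l1 hT; have T0 : 0 < T := lt_le_trans ltr01 T1.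
have t0 : 0 <= ln T by rewrite ln_ge0.
have [hx|hx] := leP (Y * (l + ln T) ^+ 2) x; [left|right]; first by lra.
have hT2 : T <= 2 * Y * (l + ln T) ^+ 2 by lra.
apply: (le_trans hT2); rewrite ler_pM2l ?mulr_gt0 //.
suff ht : ln T <= 2 * ln (50 * Y * l ^+ 2).
  by rewrite ler_sqr ?nnegrE ?lerD2l // addr_ge0 ?(le_trans t0 ht) // (le_trans ler01).
pose s := expR (ln T / 4).
have sT : s ^+ 4 = T by rewrite -expRM_natr divfK ?lnK ?posrE.
have s1 : 1 <= s by have := expR_ge1Dx (ln T / 4); rewrite -/s; lra.
have hs : ln T <= 4 * s by have := expR_ge1Dx (ln T / 4); rewrite -/s; lra.
have h5 : l + ln T <= 5 * l * s by nra.
have h25 : (l + ln T) ^+ 2 <= 25 * l ^+ 2 * s ^+ 2.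
  have -> : 25 * l ^+ 2 * s ^+ 2 = (5 * l * s) ^+ 2 by ring.
  by rewrite ler_sqr ?nnegrE //; [lra | rewrite !mulr_ge0 //; lra].
have s20 : 0 < s ^+ 2 by rewrite exprn_gt0 ?expR_gt0.
have hs2 : s ^+ 2 <= 50 * Y * l ^+ 2.
  rewrite -(ler_pM2l s20) -exprD sT.
  apply: le_trans (_ : 2 * Y * (25 * l ^+ 2 * s ^+ 2) <= _).
    by apply: (le_trans hT2); rewrite ler_pM2l // mulr_gt0.
  by rewrite le_eqVlt; apply/orP; left; apply/eqP; ring.
have : ln (s ^+ 2) <= ln (50 * Y * l ^+ 2).
  by rewrite ler_ln ?posrE // (lt_le_trans s20).
rewrite lnXn ?expR_gt0 // expRK -mulr_natr; lra.
Qed.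

Section RealBounds.
Variable R : realType.
Implicit Types (D N T W Y b l m p q t u x : R).

Lemma ln_le_subr1 x : 0 < x -> ln x <= x - 1.
Proof. by move=> x0; have := @le_ln1Dx R (x - 1); rewrite addrCA subrr addr0; apply; lra. Qed.

Lemma bonus_log_le D b l t : 1 <= D -> 1 <= l -> 0 <= t ->
  b <= 13 * D * (l + t) -> 1 + b * (1 + t) <= 14 * (D * (l + t) ^+ 2).
Proof.
move=> D1 l1 t0 hb; have u1 : 1 <= (l + t) ^+ 2 by rewrite exprn_ege1 //; lra.
have Du : 1 <= D * (l + t) ^+ 2 by rewrite mulr_ege1.
have c1 : b * (1 + t) <= 13 * D * (l + t) * (1 + t).
  by rewrite ler_wpM2r //; lra.
have c2 : 13 * D * (l + t) * (1 + t) <= 13 * D * (l + t) * (l + t).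
  by rewrite ler_wpM2l ?lerD2r // mulr_ge0 ?mulr_ge0 //; lra.
have E : 13 * D * (l + t) * (l + t) = 13 * (D * (l + t) ^+ 2) by ring.
by rewrite E in c2; lra.
Qed.

(** The constant is 56 * 100 = 336 * 3 + 328 * 14. *)
Lemma collect_terms T a b D N h p q u :
  0 <= p -> 0 <= N -> h * q <= N * (3 * (D * u)) -> b <= 14 * (D * u) ->
  T <= a + 168 * (2 * p) * h * q + 164 * (2 * p) * N * b ->
  T <= a + 56 * 100 * p * N * D * u.
Proof.
move=> p0 N0 hq hb hT.
have c1 := ler_wpM2l (mulr_ge0 p0 N0) hb.
have c2 := ler_wpM2l p0 hq.
apply: le_trans hT _; rewrite -addrA lerD2l.
have -> : 168 * (2 * p) * h * q = 336 * (p * (h * q)) by ring.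
have -> : 164 * (2 * p) * N * b = 328 * (p * N * b) by ring.
have -> : 56 * 100 * p * N * D * u =
  336 * (p * (N * (3 * (D * u)))) + 328 * (p * N * (14 * (D * u))) by ring.
by apply: lerD; apply: ler_wpM2l; [exact: ler0n | exact: c2 | exact: ler0n | exact: c1].
Qed.

(** The case T <= 2x. The forecaster's constant 16 (l - 1) is the only logarithm here, and 768 = 2 *
    2 * 12 * 16. *)
Lemma small_regime m pc p l LF W : 0 <= m * p -> m * p <= W -> 1 <= l -> l <= LF ->
  2 * (32 * m * pc + m * (2 * p) * (24 + 12 * (16 * (l - 1)))) <=
  64 * m * pc + 768 * (LF ^+ 2 * W).
Proof.
move=> mp0 mpW l1 lLF.
have LF2 : l <= LF ^+ 2.
  by rewrite expr2; apply: (le_trans lLF); rewrite ler_peMr //; lra.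
have : l * (m * p) <= LF ^+ 2 * W := ler_pM (le_trans ler01 l1) mp0 LF2 mpW.
lra.
Qed.

(** The sum [D] is at most the product (1 + L0) nS, so its logarithm splits into ln(1 + L0) and ln
    nS; with ln l <= l - 1, the logarithms of the factors other than [C] add up to at most 4 LF. *)
Lemma ln_budget_le C p N D l LF L0 nS a : 0 < C -> 0 <= ln C -> 1 <= p -> 1 <= N ->
  1 <= l -> 0 <= L0 -> 1 <= nS -> D = L0 + nS ->
  ln N = l - 1 -> ln nS <= l - 1 ->
  LF = l + ln p + ln (1 + L0) -> a = C * (p * (N * (D * l ^+ 2))) ->
  ln a <= (ln C + 4) * LF.
Proof.
move=> C0 lC p1 N1 l1 L00 S1 DE lN lS LFE ->.
have [p0 N0 l0] : [/\ 0 < p, 0 < N & 0 < l] by split; lra.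
have D0 : 0 < D by lra.
have l20 : 0 < l ^+ 2 by rewrite exprn_gt0.
rewrite !lnM ?posrE ?mulr_gt0 // lN.
have lD : ln D <= ln (1 + L0) + ln nS.
  rewrite -lnM ?posrE; [|lra|lra].
  rewrite ler_ln ?posrE ?mulr_gt0 //; [|lra|lra].
  have := ler_peMr L00 S1; rewrite DE mulrDl mul1r; lra.
have ll := ln_le_subr1 l0.
have lp : 0 <= ln p by rewrite ln_ge0.
have lL : 0 <= ln (1 + L0) by rewrite ln_ge0 //; lra.
have LF1 : 1 <= LF by lra.
have : ln C <= ln C * LF by rewrite ler_peMr.
lra.
Qed.

(** The case where the logarithmic term dominates; [C] stands for the logarithm of the constant in
    [ln_budget_le], and 9 = 1 + 2 * 4. *)
Lemma large_regime C a l LF Y W w : 0 <= C -> 0 <= a -> 0 <= l -> l <= LF ->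
  a <= (C + 4) * LF -> 0 < Y -> Y = 56 * 100 * w -> w <= W ->
  2 * Y * (l + 2 * a) ^+ 2 <= 56 * 200 * (9 + 2 * C) ^+ 2 * (LF ^+ 2 * W).
Proof.
move=> C0 a0 l0 lLF ha Y0 YE wW.
have c2 : (l + 2 * a) ^+ 2 <= ((9 + 2 * C) * LF) ^+ 2.
  rewrite ler_sqr ?nnegrE; [lra|lra|].
  by rewrite mulr_ge0 //; lra.
apply: (@le_trans _ _ (2 * Y * ((9 + 2 * C) * LF) ^+ 2)).
  by rewrite ler_pM2l // mulr_gt0.
have -> : 2 * Y * ((9 + 2 * C) * LF) ^+ 2 =
  56 * 200 * (9 + 2 * C) ^+ 2 * (LF ^+ 2 * w) by rewrite YE; ring.
apply: ler_wpM2l; last by apply: ler_wpM2l wW; exact: sqr_ge0.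
by apply: mulr_ge0 (sqr_ge0 _); apply: mulr_ge0; exact: ler0n.
Qed.

End RealBounds.

Section LogBound.
Variables (R : realType) (S A : finType) (H m : nat) (phiC phi1 delta : R).
Hypotheses (S0 : (0 < #|S|)%N) (A0 : (0 < #|A|)%N) (H0 : (0 < H)%N).
Hypotheses (m0 : (0 < m)%N) (phiC0 : 0 < phiC) (phi1_ge1 : 1 <= phi1).
Hypothesis delta01 : 0 < delta < 1.

Let nS : R := #|S|%:R.
Let nA : R := #|A|%:R.
Let nH : R := H%:R.
Let N := nS * nA * nH.
Let L0 : R := ln (1 / delta).
Let D := L0 + nS.
Let l := 1 + ln nS + ln nA + ln nH.
Let LF := log_factor #|S| #|A| H phi1 delta.

Let S1 : 1 <= nS. Proof. by rewrite ler1n. Qed.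
Let A1 : 1 <= nA. Proof. by rewrite ler1n. Qed.
Let H1 : 1 <= nH. Proof. by rewrite ler1n. Qed.
Let lS : 0 <= ln nS. Proof. exact: ln_ge0. Qed.
Let lA : 0 <= ln nA. Proof. exact: ln_ge0. Qed.
Let lH : 0 <= ln nH. Proof. exact: ln_ge0. Qed.
Let d0 : 0 < delta. Proof. by case/andP: delta01. Qed.

Let L0_ge0 : 0 <= L0.
Proof. by rewrite ln_ge0 // div1r invf_ge1 // ltW //; case/andP: delta01. Qed.

Let N1 : 1 <= N.
Proof. by rewrite /N !mulr_ege1. Qed.

Let lN : ln N = ln nS + ln nA + ln nH.
Proof.
have [s a h] : [/\ 0 < nS, 0 < nA & 0 < nH] by rewrite !ltr0n.
by rewrite /N !lnM ?posrE ?mulr_gt0.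
Qed.

Let ln4d : ln (4 / delta) <= 3 + L0.
Proof.
rewrite /L0 !ln_div ?posrE // ln1 sub0r lerD2r.
have := @ln_le_subr1 R 4 ltac:(lra); lra.
Qed.

Lemma beta_le_log T : (0 < T)%N ->
  beta S A H T (delta / 2) <= 13 * D * (l + ln T%:R).
Proof.
have s1 : 1 <= nS := S1; have a1 : 1 <= nA := A1; have h1 : 1 <= nH := H1.
have ls : 0 <= ln nS := lS; have la : 0 <= ln nA := lA; have lh : 0 <= ln nH := lH.
have L00 : 0 <= L0 := L0_ge0; have d00 : 0 < delta := d0.
move=> T0; rewrite /beta -/nS -/nA -/nH.
have N0 : 0 < N by apply: lt_le_trans N1.
have -> : 2 * nS * nA * nH / (delta / 2) = 4 / delta * N.
  by rewrite /N; field; rewrite gt_eqF.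
rewrite (@lnM R (4 / delta) N) ?posrE ?divr_gt0 // lN.
have T1 : 1 <= T%:R :> R by rewrite ler1n.
have t0 : 0 <= ln T%:R :> R by rewrite ln_ge0.
have lT : ln (8 * expR 1 * T.+1%:R) <= 9 + ln T%:R :> R.
  have e0 := expR_gt0 (1 : R).
  rewrite !lnM ?posrE ?mulr_gt0 ?ltr0n // expRK.
  have : ln T.+1%:R <= ln (2 * T%:R) :> R.
    by rewrite ler_ln ?posrE ?mulr_gt0 ?ltr0n // -natr1; lra.
  rewrite lnM ?posrE ?ltr0n //.
  have := @ln_le_subr1 R 8 ltac:(lra); have := @ln_le_subr1 R 2 ltac:(lra). by move=> h2 h8 hT; lra.
have l1 : 1 <= l by rewrite /l -!addrA lerDl !addr_ge0.
have hS : nS * ln (8 * expR 1 * T.+1%:R) <= nS * (9 + ln T%:R).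
  by rewrite ler_pM2l //; lra.
have := ln4d; rewrite /D; move: hS.
set a := ln T%:R in t0 *; set b := ln (4 / delta).
have -> : ln nS + ln nA + ln nH = l - 1 by rewrite /l; ring.
move: (nS * ln _) => w hS hb.
have p1 : l <= (L0 + nS) * l by rewrite ler_peMl //; lra.
have p2 : L0 <= L0 * l by rewrite ler_peMr.
have p3 : nS <= nS * l by rewrite ler_peMr //; lra.
have p4 : 0 <= L0 * a by rewrite mulr_ge0.
have p5 : 0 <= nS * a by rewrite mulr_ge0 //; lra.
have p6 : 0 <= L0 * l by rewrite mulr_ge0 //; lra.
lra.
Qed.

Lemma log_episodes_le T : (0 < T)%N ->
  T%:R <= 16 * m%:R * (2 * phiC) + m%:R * (2 * phi1) * (24 + 12 * (16 * ln N))
    + 168 * (2 * phi1) * nH * ln (4 / delta)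
    + 164 * (2 * phi1) * N *
      (1 + beta S A H T (delta / 2) * (1 + ln T%:R)) ->
  T%:R <= 64 * m%:R * phiC +
    (768 + 56 * 200 * (9 + 2 * ln (1400 * 200)) ^+ 2) * LF ^+ 2 *
      (m%:R * nS * nA * nH ^+ 2 * D * phi1).
Proof.
have s1 : 1 <= nS := S1; have a1 : 1 <= nA := A1; have h1 : 1 <= nH := H1.
have L00 : 0 <= L0 := L0_ge0; have NE : ln N = l - 1 by rewrite lN /l; ring.
have lS1 : ln nS <= l - 1 by rewrite -NE lN -addrA lerDl addr_ge0.
have T_beta := @beta_le_log T; have hd := ln4d; have nN : 1 <= N := N1.
have LFE : LF = l + ln phi1 + ln (1 + L0) by [].
have l1 : 1 <= l by rewrite /l -!addrA lerDl !addr_ge0.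
have DE : D = L0 + nS by [].
have NN : nH <= N by rewrite /N ler_peMl ?mulr_ege1 // (le_trans ler01).
have p0 : 0 < phi1 by exact: lt_le_trans phi1_ge1.
have m1 : 1 <= m%:R :> R by rewrite ler1n.
set W := m%:R * nS * nA * nH ^+ 2 * D * phi1.
have D1 : 1 <= D by rewrite DE; lra.
have D0 : 0 < D by exact: lt_le_trans D1.
have mp0 : 0 <= m%:R * phi1 by rewrite mulr_ge0 // ltW.
have hW1 : m%:R * phi1 <= W.
  have -> : W = m%:R * phi1 * (nS * nA * nH ^+ 2 * D) by rewrite /W; ring.
  by rewrite ler_peMr // !mulr_ege1 // exprn_ege1.
have hW2 : phi1 * N * D <= W.
  have -> : W = phi1 * N * D * (m%:R * nH) by rewrite /W /N; ring.
  by rewrite ler_peMr ?mulr_ege1 // !mulr_ge0 // ltW.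
move: lS1 T_beta hd nN LFE l1 DE NE NN hW1 hW2 D1 D0.
rewrite -/N -/W; move: (ln (4 / delta)) => q.
move: s1 a1 h1 L00; clearbody W l D N LF L0.
move: nS nA nH => s a h s1 a1 h1 L00 lS1 T_beta hd nN LFE l1 DE NE NN hW1 hW2 D1 D0.
move=> T0 /=; set bT := beta _ _ _ _ _ => hT.
have hb := T_beta T0.
have t0 : 0 <= ln T%:R :> R by rewrite ln_ge0 // ler1n.
have T1 : 1 <= T%:R :> R by rewrite ler1n.
have N0 : 0 < N by exact: lt_le_trans nN.
have b1 := bonus_log_le D1 l1 t0 hb.
have b2 : h * q <= N * (3 * (D * (l + ln T%:R) ^+ 2)).
  have u1 : 1 <= (l + ln T%:R) ^+ 2 by rewrite exprn_ege1 // (le_trans l1) // lerDl.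
  have Du : D <= D * (l + ln T%:R) ^+ 2 by rewrite ler_peMr // ltW.
  have hq : q <= 3 * (D * (l + ln T%:R) ^+ 2).
    by apply: le_trans hd _; rewrite {1}DE in Du; lra.
  apply: (@le_trans _ _ (h * (3 * (D * (l + ln T%:R) ^+ 2)))).
    by rewrite ler_wpM2l // (le_trans ler01).
  rewrite ler_wpM2r // mulr_ge0 // (le_trans _ Du) //; exact: ltW.
have := collect_terms (ltW p0) (ltW N0) b2 b1 hT.
set x := 16 * _ * _ + _; set Y := 56 * 100 * phi1 * N * D => hTY.
have Y0 : 0 < Y by rewrite /Y !mulr_gt0.
(* This is 50 * (56 * 100): the 50 of [self_log_bounded] times the constant in [Y]. *)
pose C : R := 1400 * 200.
have C0 : 0 < C by rewrite mulr_gt0 ?ltr0n.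
have lC : 0 <= ln C by rewrite ln_ge0 // mulr_ege1 ?ler1n.
have W0 : 0 <= W by exact: le_trans hW1.
have lp : 0 <= ln phi1 by rewrite ln_ge0.
have lL : 0 <= ln (1 + L0) by rewrite ln_ge0 // lerDl.
have lLF : l <= LF by rewrite LFE -addrA lerDl addr_ge0.
have LW0 : 0 <= LF ^+ 2 * W by rewrite mulr_ge0 // sqr_ge0.
have q0 : 0 <= 56 * 200 * (9 + 2 * ln C) ^+ 2 * (LF ^+ 2 * W).
  apply: mulr_ge0 LW0; apply: mulr_ge0 (sqr_ge0 _).
  by apply: mulr_ge0; exact: ler0n.
have q1 : 0 <= 768 * (LF ^+ 2 * W) := mulr_ge0 (ler0n _ _) LW0.
have q2 : 0 <= 64 * m%:R * phiC.
  by apply: mulr_ge0 (ltW phiC0); apply: mulr_ge0; exact: ler0n.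
rewrite -/C (_ : (768 + 56 * 200 * (9 + 2 * ln C) ^+ 2) * LF ^+ 2 * W =
  768 * (LF ^+ 2 * W) + 56 * 200 * (9 + 2 * ln C) ^+ 2 * (LF ^+ 2 * W)); last by ring.
rewrite addrA.
case: (self_log_bounded T1 Y0 l1 hTY) => hT'; apply: (le_trans hT').
  apply: (ler_wpDr q0); apply: le_trans (small_regime phiC mp0 hW1 l1 lLF).
  rewrite -NE; apply: ler_wpM2l; first exact: ler0n.
  by rewrite le_eqVlt; apply/orP; left; apply/eqP; rewrite /x; ring.
apply: ler_wpDl; first exact: addr_ge0.
have YE : Y = 56 * 100 * (phi1 * N * D) by rewrite /Y !mulrA.
have aE : 50 * Y * l ^+ 2 = C * (phi1 * (N * (D * l ^+ 2))).
  by rewrite YE /C; ring.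
apply: (large_regime lC _ _ lLF _ Y0 YE hW2).
- rewrite aE ln_ge0 // !mulr_ege1 ?exprn_ege1 // ?ler1n //.
- exact: le_trans l1.
- exact: (ln_budget_le C0 lC phi1_ge1 nN l1 L00 s1 DE NE lS1 LFE aE).
Qed.

End LogBound.

(** * The stopping time *)

(** Without a minimizer at hand, a policy whose largest ratio is below twice the infimum is taken.
    Its finite ratios rule out zero visitation probabilities. Since visitation probabilities are at
    most 1, the infimum dominates every positive target, which excludes -oo and zero. *)
Lemma phi_starP (R : realType) (S A : finType) (H : nat) (M : mdp R S A H)
    (c : triple S A H -> R) : (exists x, 0 < c x) ->
  phi_star M c = +oo%E \/ exists r : R, [/\ phi_star M c = r%:E,
    forall x, 0 < c x -> c x <= r &
    exists2 pi, stochastic_policy pi &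
      forall x, 0 < c x -> c x <= 2 * r * visit M pi x].
Proof.
move=> [x0 cx0]; have SA0 : (0 < #|{: S * A}|)%N by apply/card_gt0P; exists x0.2.
have ratio_le rho x : 0 < c x ->
    ((c x)%:E / (rho x)%:E <= \big[Order.max/-oo]_(x | (0 < c x)%R) ((c x)%:E / (rho x)%:E))%E.
  by move=> cx; exact: (le_bigmax_cond _ (fun x => (c x)%:E / (rho x)%:E)%E).
have lb x : 0 < c x -> ((c x)%:E <= phi_star M c)%E.
  move=> cx; apply/ereal_infP => y [rho [pi dpi ->] <-].
  apply: le_trans (ratio_le (visit M pi) x cx).
  rewrite inver; case: eqP => [_|/eqP v0]; first by rewrite gt0_muley ?lee_fin ?leey.
  rewrite -EFinM lee_fin ler_peMr ?(ltW cx) //.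
  have vp : 0 < visit M pi x by rewrite lt_neqAle eq_sym v0 visit_ge0.
  by rewrite invf_ge1 // visit_le1.
case E : (phi_star M c) => [r| |]; [right|by left|]; last first.
  by have := lb x0 cx0; rewrite E leeNy_eq.
have rge x : 0 < c x -> c x <= r by move=> /lb; rewrite E lee_fin.
exists r; split=> //; have r0 : 0 < r := lt_le_trans cx0 (rge _ cx0).
have : (phi_star M c < (2 * r)%:E)%E by rewrite E lte_fin ltr_pMl // ltr1n.
move=> /ereal_inf_lt[y [rho [pi dpi ->] <-]] ylt.
exists pi => // x cx; have := le_lt_trans (ratio_le (visit M pi) x cx) ylt.
rewrite inver; case: eqP => [_|/eqP v0]; first by rewrite gt0_muley ?lte_fin.
rewrite -EFinM lte_fin ltr_pdivrMr; first exact: ltW.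
by rewrite lt_neqAle eq_sym v0 visit_ge0.
Qed.

Section StoppingTime.
Variables (R : realType) (S A : finType) (H : nat).
Variables (d : measure_display) (T : measurableType d) (P : probability T R).
Variables (M : mdp R S A H) (c : triple S A H -> R) (delta : R).
Variables (pol : seq (traj S A H) -> 'I_H -> S -> A) (X : nat -> T -> traj S A H).
Hypothesis run : covgame_run P M c delta pol X.
Hypothesis c_pos : exists x, 0 < c x.
Hypothesis delta01 : 0 < delta < 1.

(** Covering times are integers: if none is at most [b], all are at least the next integer after
    [b], and so is their infimum. The event becomes a countable union, hence measurable. *)
Lemma tau_leE (b : R) : [set w | (tau c X w <= b%:E)%E] =
  \bigcup_(t in [set t | (0 < t)%N /\ t%:R <= b]) [set w | covered c (hist X t w)].
Proof.
apply/seteqP; split => w /=; last first.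
  move=> [t [t0 tb] cov]; apply: le_trans (_ : (t%:R)%:E <= _)%E; last by rewrite lee_fin.
  by apply: ereal_inf_lbound; exists t => //=; rewrite t0.
move=> taub; apply: contrapT => nex.
have : ((Num.truncn b).+1%:R%:E <= tau c X w)%E.
  apply/ereal_infP => y [t /= /andP[t0 cov] <-]; rewrite lee_fin ler_nat.
  rewrite ltnNge -(ler_nat R); apply/negP => tb; apply: nex; exists t => //=; split => //.
  have [b0|b0] := leP 0 b.
    by apply: le_trans tb _; have /andP[] := Num.Theory.truncn_itv b0.
  move: tb; rewrite ler_nat.
  have -> : Num.truncn b = 0%N by apply/eqP; rewrite -leqn0 Num.Theory.truncn_le_nat (lt_trans b0).
  by rewrite leqn0 => /eqP tE; rewrite tE in t0.
move=> /le_trans/(_ taub); rewrite lee_fin leNgt.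
by rewrite Num.Theory.truncnS_gt.
Qed.

Lemma tau_le_measurable (b : R) : measurable [set w | (tau c X w <= b%:E)%E].
Proof.
rewrite tau_leE; apply: bigcup_measurable => t _.
exact: (hist_measurable run t (fun u => covered c u)).
Qed.

Lemma size_hist t w : size (hist X t w) = t.
Proof. by elim: t => //= t ->. Qed.

Lemma uncovered_nil : ~~ covered c ([::] : seq (traj S A H)).
Proof.
by have [x cx] := c_pos; rewrite negb_forall; apply/existsP; exists x; rewrite -ltNge.
Qed.

Variables (Phi1 PhiC : R).
Hypotheses (PhiC0 : 0 < PhiC) (Phi10 : 0 < Phi1).

(** A finite horizon [n], the first integer above [b], is enough for Ville's inequality. Outside its
    exceptional event, a run still uncovered before time [n] would have a steady history of length
    [n], contradicting the bound [b] on such lengths. *)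
Lemma tau_le_prob (b : R) : 0 <= b ->
  (forall w, (0 < size w)%N -> steady M c delta w ->
     mixture M c delta pol PhiC Phi1 w < delta^-1 -> (size w)%:R <= b) ->
  ((1 - delta)%:E <= P [set w | (tau c X w <= b%:E)%E])%E.
Proof.
move=> b0 size_le; pose n := (Num.truncn b).+1.
have bn : b < n%:R by exact: Num.Theory.truncnS_gt.
have d0 : 0 < delta by case/andP: delta01.
have SA0 := SA_gt0 c_pos.
have id0 : 0 < delta^-1 by rewrite invr_gt0.
have [B mB [PB good]] := ville_inequality run SA0 n
  (mixture_ge0 M delta pol c_pos PhiC Phi1) id0
  (mixture_super M pol c_pos delta01 PhiC0 Phi10).
apply: (@le_trans _ _ (P (~` B))).
  rewrite probability_setC // EFinB leeB //; apply: le_trans PB _.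
  rewrite invrK lee_fin ler_piMl ?(ltW d0) //; exact: mixture_nil.
apply: le_measure; rewrite ?inE; [exact: measurableC | exact: tau_le_measurable |].
move=> w nB /=; apply: contrapT => ntau.
have unc t : (t < n)%N -> ~~ covered c (hist X t w).
  case: t => [|t] tn; first exact: uncovered_nil.
  apply/negP => cov; apply: ntau.
  suff : [set w | (tau c X w <= b%:E)%E] w by [].
  rewrite tau_leE; exists t.+1 => //=; split => //.
  have /andP[tb _] := Num.Theory.truncn_itv b0; apply: le_trans tb.
  by rewrite ler_nat -ltnS.
have gd j : (j <= n)%N -> possible M pol (hist X j w) /\
    mixture M c delta pol PhiC Phi1 (hist X j w) < delta^-1.
  by move=> jn; apply: good => // i ij; apply: unc; apply: leq_trans ij jn.
have st j : (j <= n)%N -> steady M c delta (hist X j w).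
  elim: j => //= j IH jn; split; [exact: IH (ltnW jn) | exact: unc |].
  have [po mi] := gd j (ltnW jn).
  exact: mixture_concentrated mi.
have [_ mi] := gd n (leqnn n).
have := size_le (hist X n w); rewrite size_hist => /(_ isT (st n (leqnn n)) mi).
by rewrite leNgt bn.
Qed.

End StoppingTime.

Theorem corollary4 (R : realType) :
  exists (K : R) (q : nat), 0 < K /\
  forall (S A : finType) (H : nat) (M : mdp R S A H)
    (c : triple S A H -> R) (delta : R)
    (d : measure_display) (T : measurableType d) (P : probability T R)
    (pol : seq (traj S A H) -> 'I_H -> S -> A)
    (X : nat -> T -> traj S A H),
  (forall (h : 'I_H) (s : S), (0 < h)%N ->
     exists2 pi : policy R S A H, stochastic_policy pi & 0 < state_visit M pi h s) ->
  0 < delta < 1 ->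
  (exists x, 0 < c x) ->
  (forall k, (0 < #|level_set c k|)%N ->
     regret_guarantee (R := R) (level_set c k) (wmf (level_set c k))
       (16 * ln (#|S|%:R * #|A|%:R * H%:R))) ->
  covgame_run P M c delta pol X ->
  let m := num_levels c in
  let phi1 := phi_star M (ind_supp c) in
  ((1 - delta)%:E <=
   P [set w | tau c X w <=
        (64 * m)%:E * phi_star M c
        + (K * log_factor #|S| #|A| H (fine phi1) delta ^+ q)%:E
          * ((m * #|S|%:R * #|A|%:R * H%:R ^+ 2
              * (ln (1 / delta) + #|S|%:R))%:E * phi1)])%E.
Proof.
pose K : R := 768 + 56 * 200 * (9 + 2 * ln (1400 * 200)) ^+ 2.
have K0 : 0 < K.
  apply: ltr_wpDr; last by rewrite ltr0n.
  by apply: mulr_ge0 (sqr_ge0 _); apply: mulr_ge0; exact: ler0n.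
exists K, 2%N; split=> // S A H M c delta d T P pol X _ delta01 c_pos regret run.
cbv zeta; set m := num_levels c; set phi1 := phi_star M (ind_supp c).
have [d0 d1] : 0 < delta /\ delta < 1 by case/andP: delta01.
have [m' mE m_levels] := num_levels_nat c.
have m'0 : (0 < m')%N by rewrite -(ltr0n R) -mE lt_max ltr01 orbT.
have S0 : (0 < #|S|)%N := S_gt0 M.
have A0 := A_gt0 c_pos; have H0 := H_gt0 c_pos.
have L0 : 0 <= ln (1 / delta) by rewrite ln_ge0 // div1r invf_ge1 // ltW.
have ind1 x : (0 < ind_supp c x) = (0 < c x).
  by rewrite /ind_supp ltr0n lt0b inE.
have ind_pos : exists x, 0 < ind_supp c x.
  by have [x cx] := c_pos; exists x; rewrite ind1.
have scale0 : 0 < m * #|S|%:R * #|A|%:R * H%:R ^+ 2 * (ln (1 / delta) + #|S|%:R).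
  by rewrite /m mE !mulr_gt0 ?exprn_gt0 ?ltr0n // ltr_wpDl ?ltr0n.
have m0 : 0 < 64 * m by rewrite /m mE mulr_gt0 ?ltr0n.
have lfK (r : R) : 0 <= ln r ->
    0 < K * log_factor #|S| #|A| H r delta ^+ 2.
  move=> lr; rewrite mulr_gt0 // exprn_gt0 // /log_factor -!addrA ltr_pwDl //.
  have ll : 0 <= ln (1 + ln (1 / delta)) by rewrite ln_ge0 // lerDl.
  have lnn n : (0 < n)%N -> 0 <= ln n%:R :> R by move=> n0; rewrite ln_ge0 // ler1n.
  by rewrite !addr_ge0 ?lnn.
have trivial_bound (b : \bar R) : b = +oo%E ->
    ((1 - delta)%:E <= P [set w | (tau c X w <= b)%E])%E.
  move=> ->; rewrite (_ : [set _ | _] = setT); last first.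
    by apply/seteqP; split => // w _ /=; rewrite leey.
  by rewrite probability_setT lee_fin lerBlDr lerDl ltW.
have r_ge1 (r : R) : (forall x, 0 < ind_supp c x -> ind_supp c x <= r) -> 1 <= r.
  move=> r_ge; have [x cx] := ind_pos; apply: le_trans (r_ge x cx).
  by rewrite /ind_supp inE -ind1 cx.
have phiCN : phi_star M c != -oo%E.
  by case: (phi_starP M c_pos) => [->|[r [-> _ _]]].
have [one_inf|[r1 [phi1E /r_ge1 r1_ge1 [pi1 dpi1 cover1]]]] := phi_starP M ind_pos.
  (* When [phi1] is infinite, [fine] returns 0 and its logarithm is 0, so the log factor stays
     positive and the right-hand side is indeed +oo. *)
  apply: trivial_bound; rewrite /phi1 one_inf gt0_muley ?lte_fin //.
  rewrite gt0_muley ?lte_fin ?lfK // ?ln0 // addeC addye //.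
  case: (phi_star M c) phiCN => [r _|_|//]; first by rewrite -EFinM.
  by rewrite gt0_muley ?lte_fin.
have lr1 : 0 <= ln r1 by rewrite ln_ge0.
have [c_inf|[rC [phiCE rC_ge [piC dC coverC]]]] := phi_starP M c_pos.
  apply: trivial_bound; rewrite /phi1 phi1E /= c_inf gt0_muley ?lte_fin //.
have rC0 : 0 < rC by have [x cx] := c_pos; exact: lt_le_trans (rC_ge x cx).
have r10 : 0 < r1 by exact: lt_le_trans r1_ge1.
rewrite /phi1 phiCE phi1E [fine _]/= -!EFinM -EFinD.
(* The doubling matches the factor 2 lost by the policies of [phi_starP]. *)
have c2 : 0 < 2 * rC by rewrite mulr_gt0.
have c1 : 0 < 2 * r1 by rewrite mulr_gt0.
have N1 : 1 <= #|S|%:R * #|A|%:R * H%:R :> R by rewrite !mulr_ege1 ?ler1n.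
have B0 : 0 <= 16 * ln (#|S|%:R * #|A|%:R * H%:R) :> R.
  by apply: mulr_ge0 (ler0n _ _) (ln_ge0 N1).
apply: (tau_le_prob run c_pos delta01 c2 c1) => [|w w0 sw mw].
  apply: addr_ge0; first by apply: mulr_ge0 (ltW m0) (ltW rC0).
  by apply: mulr_ge0 (ltW (lfK _ lr1)) (mulr_ge0 (ltW scale0) (ltW r10)).
have coverC' x : x \in supp c -> c x <= 2 * rC * visit M piC x.
  by rewrite inE => /coverC.
have cover1' x : x \in supp c -> 1 <= 2 * r1 * visit M pi1 x.
  move=> xs; have := cover1 x; rewrite ind1 /ind_supp xs; apply.
  by rewrite inE in xs.
have := steady_size_le c_pos delta01 (run_pol run) dC dpi1 c2 c1 coverC' cover1'
  B0 regret m_levels w0 sw mw.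
move=> /(log_episodes_le S0 A0 H0 m'0 rC0 r1_ge1 delta01 w0).
by rewrite /m mE !mulrA.
Qed.
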